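(* Let $p>1$, let $\Omega\subset\mathbb{R}^N$ ($N\ge 1$) be a bounded domain of class $C^{1,1}$, fix $\gamma>N$, and let $f\in L^\gamma(\Omega)$ satisfy $f\ge0$, $f\not\equiv0$ in $\Omega$. Let $$\Omega_f^0=\bigcup\{U\subset\Omega:\ U\text{ is open and } f=0\text{ a.e. in }U\}.$$ If $\Omega_f^0\ne\emptyset$, then $\lambda_f\le\lambda_1(\Omega_f^0)<+\infty$.
   Context: For $\lambda\in\mathbb{R}$ consider problem $(\mathcal{D}_\lambda)$: $-\Delta_p u=\lambda|u|^{p-2}u+f$ in $\Omega$, $u=0$ on $\partial\Omega$, where $\Delta_p u=\operatorname{div}(|\nabla u|^{p-2}\nabla u)$. A solution is a weak solution: $u\in W_0^{1,p}(\Omega)$ with $\int_\Omega|\nabla u|^{p-2}\nabla u\cdot\nabla\xi\,dx=\lambda\int_\Omega|u|^{p-2}u\,\xi\,dx+\int_\Omega f\xi\,dx$ for all $\xi\in W_0^{1,p}(\Omega)$. Weak solutions belong to $C^{1,\beta}(\overline\Omega)$ for some $\beta\in(0,1)$, so pointwise statements and the normal derivative $\partial_\nu u$ on $\partial\Omega$ ($\nu$ the outer unit normal) make sense. For a nonempty bounded open set $U$, $\lambda_1(U)=\inf\{\int_U|\nabla u|^p\,dx/\int_U|u|^p\,dx:\ u\in W_0^{1,p}(U)\setminus\{0\}\}$, and $\lambda_1=\lambda_1(\Omega)$. $\lambda_f\in(\lambda_1,+\infty]$ is defined as the supremum of all $a>\lambda_1$ such that $(\mathcal{D}_a)$ has a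 solution and, for any $\lambda\in(\lambda_1,a]$, every solution $u$ of $(\mathcal{D}_\lambda)$ satisfies $u<0$ in $\Omega$ and $\partial_\nu u>0$ on $\partial\Omega$. *)

(* Defs.v *)
From HB Require Import structures.
From mathcomp Require Import all_boot all_order all_algebra.
From mathcomp Require Import all_classical all_reals all_analysis.

Set Implicit Arguments.
Unset Strict Implicit.
Unset Printing Implicit Defensive.
Import Order.TTheory GRing.Theory Num.Theory.
Import numFieldNormedType.Exports.

Local Open Scope classical_set_scope.
Local Open Scope ring_scope.

(** * Lebesgue measure on [R^N], the points being the row vectors ['rV[R]_N] *)

(* The sigma-algebra is generated by the coordinate maps (as for [n.-tuple T]
   in the library), which is the Borel sigma-algebra of ['rV[R]_N]. *)
Definition row_display : measure_display.
Proof. exact: default_measure_display. Qed.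

Section measurable_row.
Context {R : realType} (N : nat).

Let coord (i : 'I_N) (x : 'rV[R]_N) : measurableTypeR R := x ord0 i.

Let row_set0 : g_sigma_preimage coord set0.
Proof. exact: sigma_algebra0. Qed.

Let row_setC A : g_sigma_preimage coord A -> g_sigma_preimage coord (~` A).
Proof. exact: sigma_algebraC. Qed.

Let row_bigcup (F : _^nat) : (forall i, g_sigma_preimage coord (F i)) ->
  g_sigma_preimage coord (\bigcup_i (F i)).
Proof. exact: sigma_algebra_bigcup. Qed.

HB.instance Definition _ := @isMeasurable.Build row_display 'rV[R]_N
  (g_sigma_preimage coord) row_set0 row_setC row_bigcup.

End measurable_row.

Section row_coordinates.
Context {R : realType}.

Lemma measurable_coord N (i : 'I_N) :
  measurable_fun [set: 'rV[R]_N] (fun x : 'rV[R]_N => x ord0 i).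
Proof.
move=> _ Y mY; rewrite setTI; apply: sub_sigma_algebra => /=.
rewrite -bigcup_seq/=; exists i => /=; first by rewrite mem_index_enum.
by exists Y => //; rewrite setTI.
Qed.

Lemma measurable_fun_row d (T : measurableType d) N (f : T -> 'rV[R]_N) :
  (forall i, measurable_fun [set: T] (fun x => f x ord0 i)) ->
  measurable_fun [set: T] f.
Proof.
move=> mf _ Y mY; rewrite setTI.
have : sigma_algebra setT [set A : set 'rV[R]_N | measurable (f @^-1` A)].
  split => /=.
  - by rewrite preimage_set0.
  - by move=> A mA; rewrite setTD preimage_setC; exact: measurableC.
  - by move=> F mF; rewrite preimage_bigcup; exact: bigcup_measurable.
move/smallest_sub; apply; last exact: mY.
rewrite -bigcup_seq/= => A [i _ [B mB <-]] /=.
by rewrite setTI -[X in measurable X]setTI; exact: mf.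
Qed.

Definition row_cons N (tx : R * 'rV[R]_N) : 'rV[R]_N.+1 :=
  \row_i oapp (tx.2 ord0) tx.1 (unlift ord0 i).

Definition row_tail N (x : 'rV[R]_N.+1) : 'rV[R]_N :=
  \row_i x ord0 (lift ord0 i).

Lemma row_consK N (x : 'rV[R]_N.+1) : row_cons (x ord0 ord0, row_tail x) = x.
Proof.
apply/rowP => i; rewrite mxE /=.
by case: unliftP => [j ->|->] //=; rewrite mxE.
Qed.

Lemma row_consE N (t : R) (x : 'rV[R]_N) :
  (row_cons (t, x) ord0 ord0, row_tail (row_cons (t, x))) = (t, x).
Proof.
congr pair; first by rewrite mxE unlift_none.
by apply/rowP => i; rewrite !mxE liftK.
Qed.

Lemma measurable_row_cons N :
  measurable_fun [set: measurableTypeR R * 'rV[R]_N] (@row_cons N).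
Proof.
apply: measurable_fun_row => i.
have -> : (fun x => row_cons x ord0 i) =
    (fun x : R * 'rV[R]_N => oapp (x.2 ord0) x.1 (unlift ord0 i)).
  by apply/funext => x; rewrite mxE.
case: unliftP => [j _|_] /=; last exact: measurable_fst.
by apply: (measurableT_comp (measurable_coord j)).
Qed.

Lemma measurable_row_split N :
  measurable_fun [set: 'rV[R]_N.+1]
    (fun x => (x ord0 ord0 : measurableTypeR R, row_tail x)).
Proof.
apply/measurable_fun_pairP; split => /=; first exact: measurable_coord.
apply: measurable_fun_row => i.
have -> : (fun x => row_tail x ord0 i) =
    (fun x : 'rV[R]_N.+1 => x ord0 (lift ord0 i)).
  by apply/funext => x /=; rewrite mxE.
exact: measurable_coord.
Qed.

End row_coordinates.

Section lebesgue_step.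
Context {R : realType} (N : nat).
Variable m : {sigma_finite_measure set 'rV[R]_N -> \bar R}.

Definition lebesgue_step : set 'rV[R]_N.+1 -> \bar R :=
  pushforward (@lebesgue_measure R \x m)%E (@row_cons R N).

Let lebesgue_step0 : lebesgue_step set0 = 0%E.
Proof. by rewrite /lebesgue_step /pushforward preimage_set0 measure0. Qed.

Let lebesgue_step_ge0 A : (0 <= lebesgue_step A)%E.
Proof. by rewrite /lebesgue_step /pushforward; exact: measure_ge0. Qed.

Let lebesgue_step_sigma_additive : semi_sigma_additive lebesgue_step.
Proof.
move=> F mF tF mUF; rewrite /lebesgue_step /pushforward preimage_bigcup.
have mc A : measurable A -> measurable (@row_cons R N @^-1` A).
  by move=> mA; rewrite -[X in measurable X]setTI; exact: measurable_row_cons.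
apply: measure_semi_sigma_additive.
- by move=> n; exact: mc.
- apply/trivIsetP => /= i j _ _ ij; rewrite -preimage_setI.
  by move/trivIsetP : tF => /(_ _ _ _ _ ij) ->//; rewrite preimage_set0.
- by rewrite -preimage_bigcup; exact: mc.
Qed.

HB.instance Definition _ := isMeasure.Build _ _ _ lebesgue_step
  lebesgue_step0 lebesgue_step_ge0 lebesgue_step_sigma_additive.

Let lebesgue_step_sigma_finite : sigma_finite setT lebesgue_step.
Proof.
have /sigma_finiteP[F [TF ndF Foo]] := sigma_finiteT (@lebesgue_measure R).
have /sigma_finiteP[G [TG ndG Goo]] := sigma_finiteT m.
pose s (x : 'rV[R]_N.+1) := (x ord0 ord0 : measurableTypeR R, row_tail x).
exists (fun n => s @^-1` (F n `*` G n)).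
  rewrite predeqE => x; split=> // _.
  have [n _ Fn] : (\bigcup_i F i) (x ord0 ord0) by rewrite -TF.
  have [k _ Gk] : (\bigcup_i G i) (row_tail x) by rewrite -TG.
  exists (maxn n k) => //; split => /=.
    by move: Fn; exact/subsetPset/ndF/leq_maxl.
  by move: Gk; exact/subsetPset/ndG/leq_maxr.
move=> k; have [mF Fk] := Foo k; have [mG Gk] := Goo k; split.
  rewrite -[X in measurable X]setTI.
  by apply: measurable_row_split => //; exact: measurableX.
rewrite /lebesgue_step /pushforward -comp_preimage.
have -> : s \o @row_cons R N = id.
  by apply/funext => -[t x]; rewrite /s /= row_consE.
by rewrite preimage_id product_measure1E// lte_mul_pinfty// ge0_fin_numE.
Qed.

HB.instance Definition _ :=
  Measure_isSigmaFinite.Build _ _ _ lebesgue_step lebesgue_step_sigma_finite.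

End lebesgue_step.

Fixpoint lebesgue {R : realType} (N : nat) :
    {sigma_finite_measure set 'rV[R]_N -> \bar R} :=
  match N with
  | 0 => \d_(0 : 'rV[R]_0)
  | n.+1 => lebesgue_step (lebesgue n)
  end.


(** * Euclidean structure and derivatives *)

Section euclidean.
Context {R : realType}.

Definition dot N (x y : 'rV[R]_N) : R := \sum_i x ord0 i * y ord0 i.

(* [`|x|] is the sup norm on ['rV[R]_N]; it gives the topology, but lengths of
   gradients and normals are Euclidean. *)
Definition enorm N (x : 'rV[R]_N) : R := Num.sqrt (dot x x).

Definition partial N (i : 'I_N) (g : 'rV[R]_N -> R) (x : 'rV[R]_N) : R :=
  'D_(delta_mx 0 i) g x.

Definition grad N (g : 'rV[R]_N -> R) (x : 'rV[R]_N) : 'rV[R]_N :=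
  \row_i partial i g x.

Fixpoint C_n (n : nat) N (g : 'rV[R]_N -> R) : Prop :=
  match n with
  | 0 => continuous g
  | k.+1 => [/\ continuous g,
               forall i x, derivable g x (delta_mx 0 i) &
               forall i, C_n k (partial i g)]
  end.

Definition boundary N (U : set 'rV[R]_N) : set 'rV[R]_N := closure U `\` U°.

End euclidean.

(** * Sobolev spaces

   An element of a space of functions on [U] is represented by a function on
   the whole of [R^N] whose values outside [U] are irrelevant, and which is
   considered up to equality almost everywhere in [U]. *)

Section sobolev.
Context {R : realType} {N : nat}.
Local Notation mu := (@lebesgue R N).
Implicit Types (U : set 'rV[R]_N) (u phi : 'rV[R]_N -> R)
  (Du : 'rV[R]_N -> 'rV[R]_N) (p : R).

Definition ae_zero U u := {ae mu, forall x, U x -> u x = 0}.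

Definition Lp p U u : Prop := u \_ U \in Lfun mu p%:E.

(* C_c^oo(U) *)
Definition test_function U phi : Prop :=
  [/\ forall n, C_n n phi, compact (closure [set x | phi x != 0]) &
      closure [set x | phi x != 0] `<=` U].

Definition weak_gradient U u Du : Prop :=
  forall phi, test_function U phi -> forall i,
    \int[mu]_(x in U) (u x * partial i phi x) =
    - \int[mu]_(x in U) (Du x ord0 i * phi x).

(* [u] is in W^{1,p}(U), with weak gradient [Du]. *)
Definition W1p p U u Du : Prop :=
  [/\ Lp p U u, forall i, Lp p U (fun x => Du x ord0 i) &
      weak_gradient U u Du].

(* [u] is in W_0^{1,p}(U), the closure of C_c^oo(U) in W^{1,p}(U), with weak
   gradient [Du]. *)
Definition W01p p U u Du : Prop :=
  W1p p U u Du /\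
  exists phi : nat -> 'rV[R]_N -> R,
    (forall k, test_function U (phi k)) /\
    (\int[mu]_(x in U) (`|u x - phi k x| `^ p
                        + enorm (Du x - grad (phi k) x) `^ p)%:E)%E
      @[k --> \oo] --> 0%E.

Definition rayleigh p U u Du : R :=
  (\int[mu]_(x in U) (enorm (Du x) `^ p)) / \int[mu]_(x in U) (`|u x| `^ p).

Definition lambda1 p U : \bar R :=
  ereal_inf [set r | exists u Du,
    [/\ W01p p U u Du, ~ ae_zero U u & r = (rayleigh p U u Du)%:E]].

End sobolev.

(** * Domains of class C^{1,1} and their normals *)

Section domains.
Context {R : realType}.

Definition domain N (U : set 'rV[R]_N) : Prop :=
  [/\ open U, connected U & U !=set0].

Definition C11 N (g : 'rV[R]_N -> R) : Prop :=
  (forall i x, derivable g x (delta_mx 0 i)) /\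
  exists L, forall x y, enorm (grad g x - grad g y) <= L * enorm (x - y).

(* The graph of [g] is taken over the coordinate hyperplane orthogonal to the
   i-th axis, [col' i y] being [y] without its i-th coordinate. [defining i s g]
   is negative on one side of the graph: above it if [s = false], below it if
   [s = true]. *)
Definition defining N (i : 'I_N) (s : bool) (g : 'rV[R]_N.-1 -> R)
    (y : 'rV[R]_N) : R :=
  (-1) ^+ s * (g (col' i y) - y ord0 i).

Definition C11_chart N (U : set 'rV[R]_N) (x : 'rV[R]_N)
    (i : 'I_N) (s : bool) (g : 'rV[R]_N.-1 -> R) : Prop :=
  C11 g /\
  exists2 r, 0 < r &
    forall y, enorm (y - x) < r -> (U y <-> defining i s g y < 0).

Definition C11_domain N (U : set 'rV[R]_N) : Prop :=
  domain U /\
  forall x, boundary U x -> exists i s g, C11_chart U x i s g.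

Definition outer_unit_normal N (U : set 'rV[R]_N) (x nu : 'rV[R]_N) : Prop :=
  exists i s g, C11_chart U x i s g /\
    nu = (enorm (grad (defining i s g) x))^-1 *: grad (defining i s g) x.

(* [v] is in C^{1,beta}(closure U), and [Dv] is the continuous extension to
   [closure U] of its gradient. *)
Definition C1beta_closure N (beta : R) (U : set 'rV[R]_N)
    (v : 'rV[R]_N -> R) (Dv : 'rV[R]_N -> 'rV[R]_N) : Prop :=
  [/\ {within closure U, continuous v},
      forall x, U x -> differentiable v x /\ grad v x = Dv x &
      exists C, forall x y, closure U x -> closure U y ->
        enorm (Dv x - Dv y) <= C * enorm (x - y) `^ beta].

End domains.

(** * The problem (D_lambda) *)

Section problem.
Context {R : realType} {N : nat}.
Local Notation mu := (@lebesgue R N).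
Variables (p : R) (Omega : set 'rV[R]_N) (f : 'rV[R]_N -> R).

Definition weak_solution (lambda : R) (u : 'rV[R]_N -> R) : Prop :=
  exists2 Du, W01p p Omega u Du &
  forall xi Dxi, W01p p Omega xi Dxi ->
    \int[mu]_(x in Omega) (enorm (Du x) `^ (p - 2) * dot (Du x) (Dxi x)) =
    lambda * \int[mu]_(x in Omega) (`|u x| `^ (p - 2) * u x * xi x)
    + \int[mu]_(x in Omega) (f x * xi x).

(* [u < 0] in Omega and [d_nu u > 0] on the boundary, for the C^{1,beta}
   representative of [u]. *)
Definition negative_with_positive_normal_derivative (u : 'rV[R]_N -> R) : Prop :=
  exists beta v Dv,
    [/\ 0 < beta < 1, C1beta_closure beta Omega v Dv,
        {ae mu, forall x, Omega x -> v x = u x},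
        forall x, Omega x -> v x < 0 &
        forall x nu, boundary Omega x -> outer_unit_normal Omega x nu ->
          0 < dot (Dv x) nu].

Definition lambda_f : \bar R :=
  ereal_sup [set a%:E | a in [set a : R |
    [/\ (lambda1 p Omega < a%:E)%E,
        exists u, weak_solution a u &
        forall lambda : R, (lambda1 p Omega < lambda%:E)%E -> lambda <= a ->
        forall u, weak_solution lambda u ->
          negative_with_positive_normal_derivative u]]].

(* The open set Omega_f^0 *)
Definition zero_region : set 'rV[R]_N :=
  \bigcup_(U in [set U | [/\ open U, U `<=` Omega & ae_zero U f]]) U.

End problem.

(* Main.v *)
(* Let [a] be an admissible parameter, [u] a solution of (D_a); then [u < 0],
   and [f] vanishes on the zero region [Z]. Picone's argument: testing the
   equation with [|phi|^p / |u|^(p-1)], [phi] in C_c^oo(Z), gives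
   [a * int |phi|^p <= int |grad phi|^p], because Young's inequality absorbs
   the mixed term in [grad u] and [grad phi] into [|grad phi|^p] and the term
   in [|grad u|^p]. By density this bounds every Rayleigh quotient on [Z] from
   below by [a].

   That test function is not smooth. It is replaced by
   [((phi^2 + eps^2)^(p/2) - eps^p) * (phi_k^2 + eps^2)^(-(p-1)/2)], where
   [phi_k] are the test functions approximating [u] in the definition of
   W_0^{1,p}: this is again in C_c^oo, so neither mollification nor
   differentiability of [u] is needed. One lets first [k -> oo], by dominated
   convergence along a subsequence, and then [eps -> 0]; the latter uses that
   [u] is bounded away from 0 on the support of [phi]. *)
Require Import Defs.
From mathcomp Require Import all_boot all_order all_algebra finmap.
From mathcomp Require Import all_classical all_reals all_analysis.
From mathcomp Require Import measurable_realfun ring lra.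
Set Implicit Arguments.
Unset Strict Implicit.
Unset Printing Implicit Defensive.
Import Order.TTheory GRing.Theory Num.Theory.
Import numFieldNormedType.Exports.
Local Open Scope classical_set_scope.
Local Open Scope ring_scope.

(** * Lebesgue measure of balls *)

(** The subtracted [eps^p] makes the first factor vanish wherever [phi] does, so that the product
    inherits the compact support of [phi]; the squares keep the second factor smooth and positive
    although the sign of [phi_k] is not controlled. The price is twofold. The subtraction leaves an
    error of order [eps^p delta^(-p) int |Du|^p], which is under control because [u <= - delta] on
    the support of [phi]. Replacing [|u|] by [(u^2 + eps^2)^(1/2)] multiplies the absorbing term in
    [|Du|^p] by [theta = |u| / (u^2 + eps^2)^(1/2) < 1], so plain Young would no longer cancel it.
    Young's inequality therefore carries the weight [theta], which puts [theta^(1-p)] in front of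
    [|grad phi|^p]; this factor tends to 1 with [eps], uniformly where [u <= - delta]. *)

Section row_space.
Context {R : realType}.

(** For [N = 0] the coordinate condition is vacuous, hence the explicit [0 < e]. *)
Lemma row_ballP N (c y : 'rV[R]_N) (e : R) :
  ball c e y <-> 0 < e /\ forall i, `|c ord0 i - y ord0 i| < e.
Proof.
split.
  move=> -[e0 H]; split=> // i; exact: H.
by move=> [e0 H]; split=> // i j; rewrite !ord1; exact: H.
Qed.

Lemma measurable_row_ball N (c : 'rV[R]_N) (e : R) : measurable (ball c e).
Proof.
have [e0|e0] := ltP 0 e; last first.
  suff -> : ball c e = set0 by exact: measurable0.
  by apply/seteqP; split=> y //= /row_ballP[+ _]; rewrite ltNge e0.
have -> : ball c e =
    \big[setI/setT]_(i <- enum 'I_N) ((fun y : 'rV[R]_N =>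
        y ord0 i) @^-1` ball (c ord0 i) e).
  rewrite -bigcap_seq; apply/seteqP; split=> y.
    by move=> /row_ballP[_ H] i _; exact: H.
  move=> H; apply/row_ballP; split=> // i; apply: (H i) => /=.
  by rewrite mem_enum.
apply: bigsetI_measurable => i _.
rewrite -[X in measurable X]setTI; apply: measurable_coord => //.
apply: open_measurable; exact: ball_open.
Qed.

(** The sigma-algebra is generated by the coordinates, not by the topology. Second countability
    bridges the two: an open set is the union of the balls it contains that have a rational centre
    and a radius [1/(n+1)], and a sup-norm ball is a box. *)
Lemma open_measurable_row N (U : set 'rV[R]_N) : open U -> measurable U.
Proof.
move=> oU.
pose c (z : 'rV[rat]_N * nat) : 'rV[R]_N := map_mx ratr z.1.
pose B z := if `[< ball (c z) z.2.+1%:R^-1 `<=` U >] then ball (c z)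
    z.2.+1%:R^-1 else set0.
have -> : U = \bigcup_z B z.
  apply/seteqP; split=> [x Ux|x [z _]]; last first.
    by rewrite /B; case: asboolP => // H; exact: H.
  have /nbhs_ballP[e /= e0 eU] := open_nbhs_nbhs (conj oU Ux).
  (* Half of [e]: a ball of this radius around a rational centre within the same distance of [x]
     contains [x] and stays in [ball x e]. *)
  have [n ne] : exists n, n.+1%:R^-1 < e / 2.
    have e20 : 0 < e / 2 by rewrite divr_gt0.
    have [n _ /(_ n (leqnn n))] := near_infty_natSinv_lt (PosNum e20).
    by move=> ?; exists n.
  have Hq i : exists q : rat, `|ratr q - x ord0 i| < n.+1%:R^-1.
    have n0 : x ord0 i < x ord0 i + n.+1%:R^-1 by rewrite ltrDl invr_gt0.
    have [q] := rat_in_itvoo n0; rewrite in_itv/= => /andP[q1 q2]; exists q.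
    by rewrite ger0_norm ?subr_ge0 ?(ltW q1)// ltrBlDl.
  have [q qx] := choice Hq.
  exists (\row_i q i, n) => //; rewrite /B.
  have xB : ball (c (\row_i q i, n)) n.+1%:R^-1 x.
    by apply/row_ballP; split; [rewrite invr_gt0|move=> i; rewrite !mxE;
        exact: qx].
  rewrite asboolT//= => y yB; apply: eU.
  rewrite (splitr e); apply: (@ball_triangle _ _ (c (\row_i q i, n))).
    by apply: ball_sym; exact: le_ball (ltW ne) _ xB.
  exact: le_ball (ltW ne) _ yB.
apply: countable_bigcupT_measurable => [|z]; first exact: countableP.
by rewrite /B; case: ifP => _; [exact: measurable_row_ball|exact: measurable0].
Qed.

Lemma continuous_measurable_row N (g : 'rV[R]_N -> R) :
  continuous g -> measurable_fun setT g.
Proof.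
move=> /continuousP cg; apply: (measurability _ (RGenOpens.measurableE R)).
move=> _ [_ [a [b ->] <-]]; rewrite setTI; apply: open_measurable_row.
exact/cg/interval_open.
Qed.

Lemma row_cons_ball N (c : 'rV[R]_N.+1) (e : R) :
  @row_cons R N @^-1` ball c e = ball (c ord0 ord0) e `*` ball (row_tail c) e.
Proof.
apply/seteqP; split=> -[t y] /=.
  move=> /row_ballP[e0 H]; split.
    by have := H ord0; rewrite !mxE unlift_none.
  by apply/row_ballP; split=> // i; have := H (lift ord0 i); rewrite !mxE liftK.
move=> [tc /row_ballP[e0 H]]; apply/row_ballP; split=> // i.
rewrite !mxE; case: unliftP => [j ->|->] //=.
by have := H j; rewrite mxE.
Qed.

(** Induction on the dimension: [row_cons] turns a sup-norm ball into an interval times a ball.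
    Finiteness gives bounded sets finite measure; positivity shows that a bump function is not a.e.
    zero. *)
Lemma lebesgue_ball N (c : 'rV[R]_N) (e : R) : 0 < e ->
  (0 < lebesgue N (ball c e) < +oo)%E.
Proof.
move=> e0; elim: N c => [|N IH] c.
  rewrite /= diracE mem_set; first by rewrite lte_fin ltr01 ltry.
  by apply/row_ballP; split=> // -[].
rewrite /= /lebesgue_step /pushforward row_cons_ball.
have mB : measurable (ball (c ord0 ord0) e) by apply: open_measurable;
    exact: ball_open.
rewrite product_measure1E//; last exact: measurable_row_ball.
have /andP[B0 Boo] := IH (row_tail c).
set m1 := (X in (X * _)%E).
have -> : m1 = (e *+ 2)%:E by exact: lebesgue_measure_ball (ltW e0).
rewrite mule_gt0 ?lte_fin ?mulrn_wgt0//=.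
by rewrite lte_mul_pinfty// ?lee_fin ?mulrn_wge0// ltW.
Qed.

Lemma bounded_set_ball N (A : set 'rV[R]_N) :
  bounded_set A -> exists2 M, 0 < M & A `<=` ball 0 M.
Proof.
move=> /ex_strict_bound_gt0[M M0 AM]; exists M => // x /AM.
by rewrite mx_norm_ball /ball_ /= sub0r normrN.
Qed.

Lemma lebesgue_bounded N (A : set 'rV[R]_N) : bounded_set A -> measurable A ->
  (lebesgue N A < +oo)%E.
Proof.
move=> /bounded_set_ball[M M0 AM] mA.
have /andP[_] := lebesgue_ball (0 : 'rV[R]_N) M0; apply: le_lt_trans.
by apply: le_measure; rewrite ?inE//; exact: measurable_row_ball.
Qed.

End row_space.

(** * Smooth functions *)

Section directional_chain_rule.
Context {R : realType} {V : normedModType R}.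

(** Restriction to the line through [x] reduces directional derivatives to one real variable, where
    the chain rule asks only for the derivative of [g] in the given direction. *)
Lemma is_derive_line (g : V -> R) (x v : V) (d : R) :
  is_derive x v g d <-> is_derive (0 : R) 1 (fun h : R => g (h *: v + x)) d.
Proof.
have E : 'D_v g x = 'D_(1 : R) (fun h : R => g (h *: v + x)) (0 : R).
  rewrite /derive; set g1 := fun h => h^-1 *: _; set g2 := fun h => h^-1 *: _.
  suff -> : g1 = g2 by [].
  by rewrite funeqE /g1 /g2 => h /=; rewrite addr0 scale0r add0r [_%:A]mulr1.
split=> -[dg <-]; constructor; rewrite ?E //.
  exact: (iffLR (derivable1P g x v) dg).
exact: (iffRL (derivable1P g x v) dg).
Qed.

Lemma is_derive_chain (F : R -> R) (g : V -> R) (x v : V) (dF dg : R) :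
  is_derive (g x) 1 F dF -> is_derive x v g dg ->
  is_derive x v (F \o g) (dF * dg).
Proof.
move=> HF /is_derive_line Hg; apply/is_derive_line.
have := @is_derive1_comp R F (fun h : R => g (h *: v + x)) 0 dF dg.
by apply => //; rewrite scale0r add0r.
Qed.

End directional_chain_rule.

Section smooth.
Context {R : realType} {N : nat}.
Implicit Types g h : 'rV[R]_N -> R.

Lemma C_n_continuous k g : C_n k g -> continuous g.
Proof. by case: k => [|k] // []. Qed.

Lemma C_n_is_derive k g i x :
  C_n k.+1 g -> is_derive x (delta_mx 0 i) g (partial i g x).
Proof. by move=> [_ dg _]; split=> //; exact: dg. Qed.

Lemma C_n_partial k g i : C_n k.+1 g -> C_n k (partial i g).
Proof. by case=> _ _ /(_ i). Qed.

Lemma C_nS k g : C_n k.+1 g -> C_n k g.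
Proof.
elim: k g => [|k IH] g; first by case.
by move=> [cg dg Pg]; split=> // i; apply: IH; exact: Pg.
Qed.

(** The common induction step: smoothness of one order more follows from exhibiting the partial
    derivatives and placing them in [C_n k]. Sums, products, powers and bumps are all treated this
    way. *)
Lemma C_n_step k g (dg : 'I_N -> 'rV[R]_N -> R) : continuous g ->
  (forall i x, is_derive x (delta_mx 0 i) g (dg i x)) ->
  (forall i, C_n k (dg i)) -> C_n k.+1 g.
Proof.
move=> cg Hg Hd; split=> // i.
suff -> : partial i g = dg i by exact: Hd.
by apply/funext => x; have [_] := Hg i x.
Qed.

Lemma C_n_cst k (c : R) : C_n k (cst c : 'rV[R]_N -> R).
Proof.
elim: k c => [|k IH] c; first exact: cst_continuous.
apply: (C_n_step (dg := fun _ => cst 0)) => //; exact: cst_continuous.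
Qed.

Lemma C_nD k g h : C_n k g -> C_n k h -> C_n k (g \+ h).
Proof.
elim: k g h => [|k IH] g h Hg Hh.
  by have cg := C_n_continuous Hg; have ch := C_n_continuous Hh; move=> x;
      exact: (continuousD (cg x) (ch x)).
apply: (C_n_step (dg := fun i => partial i g \+ partial i h)) => [|i x|i].
- by have cg := C_n_continuous Hg; have ch := C_n_continuous Hh; move=> x;
    exact: (continuousD (cg x) (ch x)).
- have Hgi := C_n_is_derive i x Hg; have Hhi := C_n_is_derive i x Hh;
    exact: is_deriveD.
- by apply: IH; exact: C_n_partial.
Qed.

Lemma C_nM k g h : C_n k g -> C_n k h -> C_n k (g \* h).
Proof.
elim: k g h => [|k IH] g h Hg Hh.
  by have cg := C_n_continuous Hg; have ch := C_n_continuous Hh; move=> x;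
      exact: (continuousM (cg x) (ch x)).
apply: (C_n_step (dg := fun i => (g \* partial i h) \+ (h \* partial i g))) =>
    [|i x|i].
- by have cg := C_n_continuous Hg; have ch := C_n_continuous Hh; move=> x;
    exact: (continuousM (cg x) (ch x)).
- have Hgi := C_n_is_derive i x Hg; have Hhi := C_n_is_derive i x Hh;
    exact: is_deriveM.
- by apply: C_nD; apply: IH; try exact: C_nS; exact: C_n_partial.
Qed.

Lemma C_n_coord k (i : 'I_N) : C_n k (fun x : 'rV[R]_N => x ord0 i).
Proof.
have cc : continuous (fun x : 'rV[R]_N => x ord0 i) by exact: coord_continuous.
case: k => // k.
apply: (C_n_step (dg := fun j => cst ((i == j)%:R))) => // [j x|j];
    last exact: C_n_cst.
apply/is_derive_line.
have -> : (fun h : R => (h *: delta_mx 0 j + x) ord0 i) = (fun h : R =>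
    h * (i == j)%:R + x ord0 i).
  by apply/funext => h; rewrite !mxE eqxx.
apply: is_derive_eq; rewrite !scaler0 addr0 add0r /GRing.scale/= mulr1//.
Qed.

(** The derivative [q * g^(q-1) * partial i g] contains a power of the same kind with another
    exponent, so the induction keeps [q] general. Positivity of [g] avoids the singularity of the
    power at 0. *)
Lemma C_n_powR k g (q : R) : C_n k g -> (forall x, 0 < g x) ->
  C_n k (fun x => g x `^ q).
Proof.
move=> + g0; have cpow r h : (forall x, 0 < h x) -> continuous h ->
    continuous (fun x => h x `^ r).
  move=> h0 ch x; apply: (@continuous_comp _ _ _ h (fun y : R => y `^ r));
      first exact: ch.
  by apply: differentiable_continuous; apply/derivable1_diffP; have [] :=
      is_derive1_powR r (h0 x).
elim: k g q g0 => [|k IH] g q g0 Hg; first exact: cpow.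
apply: (C_n_step (dg := fun i => (fun x => q * g x `^ (q - 1)) \* partial i g))
    => [|i x|i].
- by apply: cpow => //; exact: C_n_continuous Hg.
- exact: (is_derive_chain (is_derive1_powR q (g0 x)) (C_n_is_derive _ _ Hg)).
- apply: C_nM; last exact: C_n_partial.
  apply: (C_nM (C_n_cst _ q)); apply: IH => //; exact: C_nS.
Qed.

End smooth.

(** * A smooth bump on the real line *)

Section bump.
Context {R : realType}.

(* The family is closed under differentiation up to linear combinations, which
   gives smoothness by induction on the order. *)
Definition exp_bump (m : nat) (t : R) : R :=
  if 0 < t then t^-1 ^+ m * expR (- t^-1) else 0.

(** For [t > 0], a single term of the exponential series at [1/t], that of degree [m+2], bounds
    [exp(1/t)] from below. The quadratic decay makes the derivative at 0 exist and vanish. *)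
Lemma exp_bump_le m t : `|exp_bump m t| <= m.+2`!%:R * t ^+ 2.
Proof.
rewrite /exp_bump; case: ifP => t0; last by rewrite normr0 mulr_ge0// sqr_ge0.
have y0 : 0 < t^-1 by rewrite invr_gt0.
rewrite ger0_norm ?mulr_ge0 ?expR_ge0 ?exprn_ge0 ?(ltW y0)//.
rewrite expRN ler_pdivrMr ?expR_gt0// mulrAC.
rewrite -ler_pdivrMr ?exprn_gt0//.
rewrite -ler_pdivrMl ?ltr0n ?fact_gt0// -exprVn -exprD addn2 mulrC.
apply: le_trans (expR_ge1Dxn m.+1 (ltW y0)).
by rewrite lerDr ler01.
Qed.

Lemma is_derive_exp_bump m (t : R) :
  is_derive t 1 (exp_bump m) (exp_bump m.+2 t - m%:R * exp_bump m.+1 t).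
Proof.
have [t0|t0|->] := ltgtP t 0.
- apply: (near_eq_is_derive (f := cst 0)); last first.
    by apply: is_derive_eq; rewrite /exp_bump ltNge (ltW t0)/= mulr0 subr0.
  near=> z; rewrite /exp_bump; case: ifPn => // /ltW; rewrite leNgt => /negP[].
  by near: z; exact: lt_nbhsl.
- apply: (near_eq_is_derive (f := fun t : R => t^-1 ^+ m * expR (- t^-1))).
    by near=> z; rewrite /exp_bump ifT//; near: z; exact: lt_nbhsr.
  have tn0 : t != 0 by rewrite gt_eqF.
  have HV : is_derive t 1 (fun t : R => t^-1) (- t ^- 2).
    by apply: is_derive_eq (is_deriveV tn0 (is_derive_id t 1)) _;
        rewrite [LHS]mulr1.
  have HE : is_derive t 1 (fun t : R => expR (- t^-1)) (expR (- t^-1) * t ^- 2).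
    apply: (is_derive1_comp (f := expR) (g := fun t => - t^-1)).
    by apply: is_derive_eq; rewrite opprK.
  have HX : is_derive t 1 (fun t : R => t^-1 ^+ m) (m%:R * t^-1 ^+ m.-1 * - t
      ^- 2).
    have -> : (fun t : R => t^-1 ^+ m) = (fun t : R => t^-1) ^+ m.
      by apply/funext => z; rewrite exprfctE.
    apply: is_derive_eq.
    by rewrite /GRing.scale/=.
  apply: is_derive_eq (is_deriveM HX HE) _.
  rewrite /GRing.scale/= /exp_bump t0 -exprVn.
  case: m {HX} => [|m]; first by rewrite !mul0r mulr0 addr0 subr0 expr0 mul1r
      mulrC.
  by rewrite /= [t^-1 ^+ m.+3]exprS !exprS; ring.
(* At the junction the quadratic bound makes the difference quotient at most [(m+2)! * |h|] in
   absolute value. *)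
- rewrite /exp_bump ltxx mulr0 subr0 -/(exp_bump m).
  have H : (fun h : R => h^-1 *: ((exp_bump m \o shift 0) (h *: 1) - exp_bump m
      0)) @ 0^' --> (0 : R).
    apply/cvgr0Pnorm_le => e e0; near=> h.
    have h0 : h != 0 by near: h; exact: nbhs_dnbhs_neq.
    rewrite /= addr0 [_%:A]mulr1 {2}/exp_bump ltxx subr0 normrM normfV.
    rewrite ler_pdivrMl ?normr_gt0//; apply: le_trans (exp_bump_le _ _) _.
    rewrite -real_normK ?num_real// expr2 mulrCA ler_wpM2l//.
    rewrite -ler_pdivlMl ?ltr0n ?fact_gt0//; near: h.
    apply: dnbhs0_le.
    by rewrite mulr_gt0// invr_gt0 ltr0n fact_gt0.
  split; first by apply/cvg_ex; exists 0.
  exact/cvg_lim.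
Unshelve. all: by end_near. Qed.

Lemma C_n_exp_bump N k m (g : 'rV[R]_N -> R) :
  C_n k g -> C_n k (exp_bump m \o g).
Proof.
have cb r (h : 'rV[R]_N -> R) : continuous h -> continuous (exp_bump r \o h).
  move=> ch x; apply: (@continuous_comp _ _ _ h (exp_bump r)); first exact: ch.
  apply: differentiable_continuous; apply/derivable1_diffP.
  by have [] := is_derive_exp_bump r (h x).
elim: k m g => [|k IH] m g Hg; first exact: cb.
apply: (C_n_step (dg := fun i => ((exp_bump m.+2 \o g)
    \+ (cst (- m%:R) \* (exp_bump m.+1 \o g))) \* partial i g)) => [|i x|i].
- by apply: cb; exact: C_n_continuous Hg.
- apply: is_derive_eq (is_derive_chain (is_derive_exp_bump m (g x))
    (C_n_is_derive i x Hg)) _.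
  by rewrite /= mulNr.
- apply: C_nM; last exact: C_n_partial.
  apply: C_nD; first by apply: IH; exact: C_nS.
  by apply: C_nM; [exact: C_n_cst|apply: IH; exact: C_nS].
Qed.

End bump.

(** * Integration by parts *)

Section integration_by_parts.
Context {R : realType}.

Lemma compact_support_bounded N (g : 'rV[R]_N -> R) (M : R) : continuous g ->
  (forall x, ~ ball 0 M x -> g x = 0) ->
  exists2 B, 0 < B & forall x, `|g x| <= B.
Proof.
move=> cg g0; pose r := `|M| + 1; have r0 : 0 < r by rewrite ltr_wpDl.
have cK : compact (closed_ball (0 : 'rV[R]_N) r).
  apply: bounded_closed_compact; last exact: closed_ball_closed.
  exists r; split; first exact: num_real.
  move=> y ry x; rewrite closed_ballE// /closed_ball_/= sub0r normrN => h.
  exact: le_trans h (ltW ry).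
have /compact_bounded/ex_strict_bound_gt0[B B0 gB] :
    compact (g @` closed_ball (0 : 'rV[R]_N) r).
  by apply: continuous_compact => //; exact: continuous_subspaceT.
exists B => // x; have [xM|/g0->] := pselect (ball 0 M x);
    last by rewrite normr0 ltW.
apply/ltW/gB; exists x => //; apply: subset_closed_ball.
by apply: le_ball xM; rewrite (le_trans (ler_norm M))// lerDl.
Qed.

Lemma integrable_bounded_support N (g : 'rV[R]_N -> R) (B M : R) :
  measurable_fun setT g ->
  (forall x, `|g x| <= B) -> (forall x, ~ ball 0 M x -> g x = 0) ->
  (lebesgue N).-integrable setT (EFin \o g).
Proof.
move=> mg gB g0.
have -> : EFin \o g = (EFin \o g) \_ (ball 0 M).
  apply/funext => x; rewrite patchE; case: ifPn => //.
  by rewrite notin_setE => /g0 /= ->.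
apply/(integrable_mkcond _ (measurable_row_ball _ _)).
apply: measurable_bounded_integrable => //.
- exact: measurable_row_ball.
- have [M0|M0] := ltP 0 M; first by case/andP: (lebesgue_ball (0 : 'rV[R]_N)
    M0).
  suff -> : ball (0 : 'rV[R]_N) M = set0 by rewrite measure0 ltry.
  by apply/seteqP; split=> y //= /row_ballP[+ _]; rewrite ltNge M0.
- exact: measurable_funTS.
- exists B; split; first exact: num_real.
  by move=> y By x _ /=; exact: le_trans (gB x) (ltW By).
Qed.

Lemma partial_eq0 N (i : 'I_N) (g : 'rV[R]_N -> R) (x : 'rV[R]_N) :
  (\forall y \near x, g y = 0) -> partial i g x = 0.
Proof.
by move=> H; rewrite /partial (near_eq_derive (g := cst 0))// derive_cst.
Qed.

(** The complement of a ball need not be open. Enlarging the radius by 1 leaves room for a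
    neighbourhood, so that the derivatives of a function vanishing outside [ball 0 M] vanish outside
    [ball 0 (M + 1)]. *)
Lemma ball_complement_near N (M : R) (x : 'rV[R]_N) : ~ ball 0 (M + 1) x ->
  \forall y \near x, ~ ball 0 M y.
Proof.
move=> xM; apply/nbhs_ballP; exists 1 => //= y xy yM; apply: xM.
by apply: ball_triangle yM _; exact: ball_sym.
Qed.

Lemma integral_derive_compact_support (h dh : R -> R) (M : R) :
  (forall t : R, is_derive t 1 h (dh t)) -> continuous dh ->
  (forall t : R, ~ ball 0 M t -> h t = 0) -> (forall t : R, ~ ball 0 M t ->
      dh t = 0) ->
  (\int[lebesgue_measure]_t (dh t)%:E = 0)%E.
Proof.
move=> hdh cdh h0 dh0.
have ch : continuous h.
  move=> t; apply: differentiable_continuous; apply/derivable1_diffP.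
  by have [] := hdh t.
(* [M] has no prescribed sign; this bound is positive and puts both endpoints of [[-a, a]] outside
   the ball. *)
pose a : R := `|M| + 1.
have a0 : 0 < a by rewrite ltr_wpDl.
have Ma : M <= a by rewrite (le_trans (ler_norm M))// lerDl.
have out (t : R) : `|t| >= a -> ~ ball 0 M t.
  move=> ta; rewrite -ball_normE /= sub0r normrN => tM.
  by have := le_lt_trans ta (lt_le_trans tM Ma); rewrite ltxx.
transitivity (\int[lebesgue_measure]_(t in `[(- a)%R, a]%classic) (dh t)%:E)%E.
  rewrite [RHS]integral_mkcond; apply: eq_integral => t _.
  rewrite patchE; case: ifPn => //; rewrite notin_setE /= in_itv/= -ler_norml.
  by move/negP; rewrite -ltNge => /ltW/out/dh0 ->.
rewrite (@continuous_FTC2 _ dh h).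
- by rewrite !h0 ?sube0//; apply: out; rewrite ?normrN gtr0_norm.
- by rewrite (lt_trans _ a0)// oppr_lt0.
- exact: continuous_subspaceT.
- split.
  + by move=> t _; have [] := hdh t.
  + by apply: cvg_at_right_filter; exact: ch.
  + by apply: cvg_at_left_filter; exact: ch.
- by move=> t _; rewrite derive1E; have [_ ->] := hdh t.
Qed.

Lemma continuous_row_consr N (t : R) : continuous (fun y : 'rV[R]_N =>
    row_cons (t, y)).
Proof.
move=> y U /nbhs_ballP[e /= e0 eU]; apply/nbhs_ballP; exists e => //= z yz.
apply: eU; suff : (@row_cons R N @^-1` ball (row_cons (t, y)) e) (t, z) by [].
have [E1 E2] := row_consE t y.
by rewrite row_cons_ball E1 E2; split=> //=; exact: ballxx.
Qed.

Lemma continuous_row_consl N (y : 'rV[R]_N) : continuous (fun t : R =>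
    row_cons (t, y)).
Proof.
move=> t U /nbhs_ballP[e /= e0 eU]; apply/nbhs_ballP; exists e => //= s ts.
apply: eU; suff : (@row_cons R N @^-1` ball (row_cons (t, y)) e) (s, y) by [].
have [E1 E2] := row_consE t y.
by rewrite row_cons_ball E1 E2; split=> //=; exact: ballxx.
Qed.

Lemma row_cons_scale0 N (t s : R) (y : 'rV[R]_N) :
  row_cons (s + t, y) = s *: delta_mx 0 ord0 + row_cons (t, y).
Proof.
apply/rowP => i; rewrite !mxE; case: unliftP => [j ->|->] /=.
  by rewrite mulr0 add0r.
by rewrite mulr1.
Qed.

Lemma row_cons_scaler N (t s : R) (j : 'I_N) (y : 'rV[R]_N) :
  row_cons (t, s *: delta_mx 0 j + y) =
  s *: delta_mx 0 (lift ord0 j) + row_cons (t, y).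
Proof.
apply/rowP => i; rewrite !mxE; case: unliftP => [k ->|->] /=.
  by rewrite !mxE (inj_eq (@lift_inj _ ord0)).
by rewrite mulr0 add0r.
Qed.

Lemma integral_lebesgueS N (F : 'rV[R]_N.+1 -> \bar R) :
  (lebesgue N.+1).-integrable setT F ->
  (lebesgue_measure \x lebesgue N)%E.-integrable setT (F \o @row_cons R N) /\
  (\int[lebesgue N.+1]_x F x =
   \int[(lebesgue_measure \x lebesgue N)%E]_z F (row_cons z))%E.
Proof.
move=> /integrableP[mF Foo].
have mc : measurable_fun setT (@row_cons R N) by exact: measurable_row_cons.
have iF : (lebesgue_measure \x lebesgue N)%E.-integrable setT (F \o @row_cons R
    N).
  apply/integrableP; split; first exact: measurableT_comp.
  move: Foo; rewrite /= /lebesgue_step ge0_integral_pushforward//.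
  exact: measurableT_comp.
split=> //; rewrite /= /lebesgue_step integral_pushforward//.
Qed.

(** Induction on the dimension with Fubini. If [i] is the coordinate split off by [row_cons], the
    inner integral is one-dimensional and the fundamental theorem of calculus applies; otherwise
    that coordinate is frozen and the induction hypothesis covers the slice. *)
Lemma integral_partial_eq0 N (i : 'I_N) (g : 'rV[R]_N -> R) (M : R) :
  (forall x, derivable g x (delta_mx 0 i)) -> continuous (partial i g) ->
  (forall x, ~ ball 0 M x -> g x = 0) ->
  (\int[lebesgue N]_x (partial i g x)%:E = 0)%E.
Proof.
elim: N i g => [[]//|N IH] i g dg cg g0.
have pg0 x : ~ ball 0 (M + 1) x -> partial i g x = 0.
  move=> /ball_complement_near xM; apply: partial_eq0.
  by apply: filterS xM => y; exact: g0.
have [B B0 gB] := compact_support_bounded cg pg0.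
have iF := integrable_bounded_support (continuous_measurable_row cg) gB pg0.
have [iG ->] := integral_lebesgueS iF.
have consM (r : R) t y : ~ ball (0 : R) r t ->
    ~ ball (0 : 'rV[R]_N.+1) r (row_cons (t, y)).
  by move=> tr /row_ballP[r0 /(_ ord0)]; rewrite !mxE unlift_none.
have consM' (r : R) t y : ~ ball (0 : 'rV[R]_N) r y ->
    ~ ball (0 : 'rV[R]_N.+1) r (row_cons (t, y)).
  move=> tr /row_ballP[r0 H]; apply: tr; apply/row_ballP; split=> // k.
  by have := H (lift ord0 k); rewrite !mxE liftK.
have dgl x : is_derive x (delta_mx 0 i) g (partial i g x) by split.
case: (unliftP ord0 i) => [j|] Ei.
  rewrite -integral12_prod_meas1//; apply: integral0_eq => t _.
  pose gt (y : 'rV[R]_N) := g (row_cons (t, y)).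
  have dgt y : is_derive y (delta_mx 0 j) gt (partial i g (row_cons (t, y))).
    apply/is_derive_line; rewrite /gt.
    under eq_fun do rewrite row_cons_scaler -Ei.
    exact: (is_derive_line g (row_cons (t, y)) (delta_mx 0 i) _).1.
  have pgt : partial j gt = (fun y => partial i g (row_cons (t, y))).
    by apply/funext => y; have [_] := dgt y.
  have := IH j gt; rewrite pgt; apply.
  - by move=> y; have [] := dgt y.
  - move=> y; apply: (@continuous_comp _ _ _ (fun y => row_cons (t,
      y)) (partial i g)).
      exact: continuous_row_consr.
    exact: cg.
  - by move=> y /consM'-/(_ t)/g0.
rewrite -integral21_prod_meas1//; apply: integral0_eq => y _.
apply: (@integral_derive_compact_support (fun t => g (row_cons (t,
    y))) _ (M + 1)).
- move=> t; have := is_derive_line g (row_cons (t,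
    y)) (delta_mx 0 i) (partial i g (row_cons (t, y))).
  move=> [/(_ (dgl _)) H _].
  have -> : (fun t => g (row_cons (t, y))) =
      (fun h : R => g (h *: delta_mx 0 i + row_cons (t, y))) \o (fun s =>
          s - t).
    by apply/funext => s /=; rewrite Ei -row_cons_scale0 subrK.
  rewrite -[partial _ _ _]mulr1.
  apply: is_derive1_comp; first by rewrite subrr.
  by apply: is_derive_eq; rewrite subr0.
- move=> t; apply: (@continuous_comp _ _ _ (fun t => row_cons (t,
    y)) (partial i g)); last exact: cg.
  exact: continuous_row_consl.
- move=> t tM; apply: g0; apply: consM => tM'; apply: tM.
  by apply: le_ball tM'; rewrite lerDl.
- by move=> t /consM-/(_ y)/pg0.
Qed.
End integration_by_parts.

(** * Elementary inequalities *)

Section euclidean_norm.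
Context {R : realType} {N : nat}.
Implicit Types x y : 'rV[R]_N.

Lemma dotC x y : dot x y = dot y x.
Proof. by apply: eq_bigr => i _; rewrite mulrC. Qed.

Lemma dotDl x y z : dot (x + y) z = dot x z + dot y z.
Proof. by rewrite -big_split; apply: eq_bigr => i _; rewrite mxE mulrDl. Qed.

Lemma dotZl c x y : dot (c *: x) y = c * dot x y.
Proof. by rewrite mulr_sumr; apply: eq_bigr => i _; rewrite mxE mulrA. Qed.

Lemma dotDr x y z : dot z (x + y) = dot z x + dot z y.
Proof. by rewrite dotC dotDl !(dotC _ z). Qed.

Lemma dotZr c x y : dot x (c *: y) = c * dot x y.
Proof. by rewrite dotC dotZl dotC. Qed.

Lemma dot_ge0 x : 0 <= dot x x.
Proof. by apply: sumr_ge0 => i _; rewrite -expr2 sqr_ge0. Qed.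

Lemma enorm_ge0 x : 0 <= enorm x.
Proof. exact: sqrtr_ge0. Qed.

Lemma sqr_enorm x : enorm x ^+ 2 = dot x x.
Proof. by rewrite sqr_sqrtr// dot_ge0. Qed.

Lemma enorm0 : enorm (0 : 'rV[R]_N) = 0.
Proof.
by rewrite /enorm (_ : dot 0 0 = 0) ?sqrtr0// /dot big1// => i _;
    rewrite mxE mul0r.
Qed.

Lemma enormN x : enorm (- x) = enorm x.
Proof.
by rewrite /enorm -scaleN1r dotZl dotZr mulrA mulrNN mulr1 mul1r.
Qed.

Lemma normr_coord_le x i : `|x ord0 i| <= enorm x.
Proof.
rewrite -sqrtr_sqr ler_wsqrtr// /dot (bigD1 i)//= -expr2 lerDl.
by apply: sumr_ge0 => j _; rewrite -expr2 sqr_ge0.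
Qed.

Lemma enorm_le_sum x : enorm x <= \sum_i `|x ord0 i|.
Proof.
have S0 : 0 <= \sum_i `|x ord0 i| by exact: sumr_ge0.
rewrite -(ger0_norm S0) -sqrtr_sqr ler_wsqrtr// expr2 mulr_suml.
apply: ler_sum => i _; rewrite -[_ * _]ger0_norm -?expr2 ?sqr_ge0// normrX
    expr2.
by rewrite ler_wpM2l// (bigD1 i)//= lerDl sumr_ge0.
Qed.

Lemma cauchy_schwarz x y : `|dot x y| <= enorm x * enorm y.
Proof.
rewrite -sqrtr_sqr /enorm -sqrtrM ?dot_ge0// ler_wsqrtr//.
have [c0|c0] := eqVneq (dot y y) 0.
  suff -> : dot x y = 0 by rewrite expr0n/= c0 mulr0.
  rewrite /dot big1// => i _.
  have : `|y ord0 i| <= 0 by apply: le_trans (normr_coord_le y i) _;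
      rewrite /enorm c0 sqrtr0.
  by rewrite normr_le0 => /eqP ->; rewrite mulr0.
(* The squared length of this vector is [|y|^2 (|x|^2 |y|^2 - (x.y)^2)]. *)
have := dot_ge0 (dot y y *: x + (- dot x y) *: y).
rewrite !(dotDl, dotDr, dotZl, dotZr) (dotC y x).
rewrite [X in 0 <= X](_ : _ = dot y y * (dot x x * dot y y - dot x y ^+ 2));
    last by ring.
by rewrite pmulr_rge0 ?subr_ge0// lt_neqAle eq_sym c0 dot_ge0.
Qed.

Lemma enorm_triangle x y : enorm (x + y) <= enorm x + enorm y.
Proof.
rewrite -ler_sqr ?nnegrE ?addr_ge0 ?enorm_ge0// sqr_enorm.
rewrite !(dotDl, dotDr) (dotC y x) sqrrD !sqr_enorm addrA lerD2r -addrA lerD2l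
    mulr2n.
by rewrite lerD// (le_trans (ler_norm _))// cauchy_schwarz.
Qed.

End euclidean_norm.

Section power_inequalities.
Context {R : realType}.
Implicit Types (p a b : R).

Lemma powRD_le p a b : 0 <= p -> 0 <= a -> 0 <= b ->
  (a + b) `^ p <= 2 `^ p * (a `^ p + b `^ p).
Proof.
move=> p0 a0 b0; wlog ab : a b a0 b0 / a <= b.
  move=> W; have [|/ltW] := leP a b; first exact: W.
  by rewrite addrC [X in _ * X]addrC; exact: W.
apply: (@le_trans _ _ ((2 * b) `^ p)).
  by rewrite ge0_ler_powR ?nnegrE ?addr_ge0 ?mulr_ge0//; lra.
by rewrite powRM// ler_wpM2l ?powR_ge0// lerDr powR_ge0.
Qed.

(** The summand [0^p] accounts for the empty sum, whose power is 1 when [p = 0]. *)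
Lemma powR_sum_le p (I : Type) (s : seq I) : 0 <= p ->
  exists2 C, 0 <= C & forall F : I -> R, (forall i, 0 <= F i) ->
    (\sum_(i <- s) F i) `^ p <= C * (0 `^ p + \sum_(i <- s) F i `^ p).
Proof.
move=> p0; elim: s => [|i s [C C0 IH]].
  by exists 1 => // F _; rewrite !big_nil addr0 mul1r.
exists (2 `^ p * (1 + C)) => [|F F0]; first by rewrite mulr_ge0 ?powR_ge0
    ?addr_ge0.
rewrite !big_cons; have S0 : 0 <= \sum_(j <- s) F j by exact: sumr_ge0.
apply: le_trans (powRD_le p0 (F0 i) S0) _; rewrite -mulrA ler_wpM2l ?powR_ge0//.
have T0 : 0 <= \sum_(j <- s) F j `^ p by apply: sumr_ge0 => j _;
    exact: powR_ge0.
have := IH F F0; have := powR_ge0 (F i) p; have := powR_ge0 0 p; nra.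
Qed.

(** The weight sits on the factor that will carry [|Du|], so that a term multiplied by [theta] can
    absorb it. *)
Lemma young_weighted p theta X Y : 1 < p -> 0 < theta -> 0 <= X -> 0 <= Y ->
  p * (X `^ (p - 1) * Y) <=
  (p - 1) * (theta * X `^ p) + theta `^ (1 - p) * Y `^ p.
Proof.
move=> p1 t0 X0 Y0.
have pp : 0 < p by lra.
have pm : 0 < p - 1 by lra.
pose q := p / (p - 1); have q0 : 0 < q by rewrite divr_gt0.
(* Chosen so that [c^q = theta] and [c^(-p) = theta^(1-p)] in Young's inequality for [Y / c] and
   [X^(p-1) * c]. *)
pose c := theta `^ ((p - 1) / p); have c0 : 0 < c by rewrite powR_gt0.
have := @conjugate_powR _ (Y / c) (X `^ (p - 1) * c) p q.
have -> : Y / c * (X `^ (p - 1) * c) = X `^ (p - 1) * Y by field;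
    exact: lt0r_neq0.
rewrite divr_ge0 ?(ltW c0)// mulr_ge0 ?powR_ge0 ?(ltW c0)//.
move=> /(_ isT isT pp q0).
have pq : p^-1 + q^-1 = 1 by rewrite /q; field; rewrite !gt_eqF.
move=> /(_ pq) H.
have -> : theta `^ (1 - p) * Y `^ p = (Y / c) `^ p.
  rewrite powRM ?invr_ge0 ?(ltW c0)// mulrC; congr (_ * _).
  rewrite -powR_inv1 ?(ltW c0)// /c -!powRrM; congr (_ `^ _); field;
      exact: lt0r_neq0.
have -> : theta * X `^ p = (X `^ (p - 1) * c) `^ q.
  rewrite powRM ?powR_ge0 ?(ltW c0)// mulrC /c -!powRrM; congr (_ `^ _ * _).
    by rewrite /q; field; rewrite gt_eqF.
  rewrite -[LHS]powRr1 ?(ltW t0)//; congr (_ `^ _).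
  by rewrite /q; field; rewrite !gt_eqF.
apply: le_trans (ler_wpM2l (ltW pp) H) _.
rewrite le_eqVlt; apply/orP; left; apply/eqP; rewrite /q; field.
by rewrite !gt_eqF.
Qed.

End power_inequalities.

(** * Convergence almost everywhere *)

Section dominated_convergence.
Context d (T : measurableType d) (R : realType).
Variables (mu : {measure set T -> \bar R}) (D : set T) (mD : measurable D).

Lemma dominated_Rintegral (F : nat -> T -> R) (f S : T -> R) :
  (forall k, measurable_fun D (F k)) -> measurable_fun D f ->
  {ae mu, forall x, D x -> F ^~ x @ \oo --> f x} ->
  mu.-integrable D (EFin \o S) ->
  {ae mu, forall x, D x -> forall k, `|F k x| <= S x} ->
  mu.-integrable D (EFin \o f) /\
  \int[mu]_(x in D) F k x @[k --> \oo] --> \int[mu]_(x in D) f x.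
Proof.
move=> mF mf Ff iS FS.
have mFE k : measurable_fun D (EFin \o F k) by exact/measurable_EFinP.
have mfE : measurable_fun D (EFin \o f) by exact/measurable_EFinP.
have Ff' : {ae mu, forall x, D x -> (EFin \o F k) x @[k --> \oo] -->
    (EFin \o f) x}.
  apply: filterS Ff => x H Dx; apply: cvg_EFin; first by apply: nearW.
  exact: H.
have FS' : {ae mu, forall x k, D x -> (`|(EFin \o F k) x| <= (EFin \o S) x)%E}.
  by apply: filterS FS => x H k Dx; rewrite /= lee_fin; exact: H.
have [fi _ fc] := dominated_convergence mD mFE mfE Ff' iS FS'.
split=> //; apply: fine_cvg; rewrite fineK; first exact: fc.
exact: integrable_fin_num.
Qed.

(* The subsequence is chosen with [int e (s k) <= 2^-(k+1)]; [S] is the sum of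
   the series. *)
Lemma dominated_subsequence (e : nat -> T -> R) :
  (forall k, measurable_fun D (e k)) -> (forall k x, 0 <= e k x) ->
  (\int[mu]_(x in D) (e k x)%:E)%E @[k --> \oo] --> 0%E ->
  exists (s : nat -> nat) (S : T -> R), mu.-integrable D (EFin \o S) /\
    {ae mu, forall x, D x ->
      e (s k) x @[k --> \oo] --> 0 /\ forall k, e (s k) x <= S x}.
Proof.
move=> me e0 ie.
have Hs k : exists m, (\int[mu]_(x in D) (e m x)%:E <=
    (1 / (2 ^ k.+1)%:R)%:E)%E.
  have r0 : 0 < 1 / (2 ^ k.+1)%:R :> R by rewrite divr_gt0// ltr0n expn_gt0.
  move/fine_cvgP : ie => [[m _ fin] /cvgr0Pnorm_le/(_ _ r0)[m' _ Hm]].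
  exists (maxn m m'); rewrite -[leLHS]fineK ?fin ?lee_fin//=;
      last exact: leq_maxl.
  by apply: le_trans (ler_norm _) _; apply: Hm; exact: leq_maxr.
have [s Hs'] := choice Hs.
pose Se x := (\sum_(0 <= k <oo) (e (s k) x)%:E)%E.
have mE k : measurable_fun D (fun x => (e (s k) x)%:E) by
    exact/measurable_EFinP.
have e0E k x : D x -> (0 <= (e (s k) x)%:E)%E by rewrite lee_fin.
have mSe : measurable_fun D Se by apply: ge0_emeasurable_sum => // k x Dx _;
    exact: e0E.
have Se0 x : (0 <= Se x)%E by apply: nneseries_ge0 => k _ _; rewrite lee_fin.
have iSe : mu.-integrable D Se.
  apply/integrableP; split=> //; under eq_integral => x _ do rewrite gee0_abs//.
  rewrite integral_nneseries//.
  apply: le_lt_trans (ltry 1); apply: le_trans (epsilon_trick0 xpredT ler01).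
  apply: lee_nneseries => [k _ _|k _]; last exact: Hs'.
  by apply: integral_ge0 => x Dx; rewrite lee_fin.
exists s, (fine \o Se); split.
  apply/integrableP; split; first by apply/measurable_EFinP;
      exact: measurableT_comp.
  case/integrableP : iSe => _; apply: le_lt_trans; apply: ge0_le_integral => //.
  - by apply: measurableT_comp => //; apply/measurable_EFinP;
      exact: measurableT_comp.
  - exact: measurableT_comp.
  - move=> x Dx; rewrite (gee0_abs (Se0 x)) /=.
    have := Se0 x; case: (Se x) => [r|_|]//=; rewrite ?normr0 ?leey// lee_fin
        => r0.
    by rewrite lee_fin ger0_norm.
(* Where the series is finite, each term is at most its sum and the terms tend to 0. *)
have := integrable_ae mD iSe; apply: filterS => x H Dx; have {}H := H Dx.
have le k : \sum_(0 <= i < k) e (s i) x <= fine (Se x).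
  rewrite -lee_fin fineK// -sumEFin.
  by apply: nneseries_lim_ge => i _ _; rewrite lee_fin.
split=> [|k].
  apply: cvg_series_cvg_0; apply: nondecreasing_is_cvgn.
    by apply: nondecreasing_series => i _ _.
  by exists (fine (Se x)) => _ [k _ <-]; exact: le.
apply: le_trans (le k.+1); rewrite big_nat_recr//= lerDr.
by apply: sumr_ge0.
Qed.

End dominated_convergence.

(** * Test functions and Sobolev spaces *)

Section sobolev_facts.
Context {R : realType} {N : nat}.
Local Notation mu := (@lebesgue R N).
Implicit Types (U : set 'rV[R]_N) (u phi : 'rV[R]_N -> R) (p : R).

Lemma Lp_powR p U u : 0 < p -> measurable U ->
  Lp p U u <-> measurable_fun U u /\
    mu.-integrable U (EFin \o (fun x => `|u x| `^ p)).
Proof.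
move=> p0 mU.
have E : (\int[mu]_x `|(EFin \o (u \_ U)) x| `^ p = \int[mu]_(x in U) `|(`|u x|
    `^ p)%:E|)%E.
  rewrite [RHS]integral_mkcond; apply: eq_integral => x _; rewrite /= !patchE.
  case: ifPn => _ /=; first by rewrite [in RHS]ger0_norm// powR_ge0.
  by rewrite normr0 powR0// gt_eqF.
have pV : p^-1 != 0 by rewrite invr_eq0 gt_eqF.
split.
  move=> /andP[/set_mem mu_ /set_mem]; rewrite /= /finite_norm unlock E => fu.
  have mUu : measurable_fun U u by apply/measurable_restrictT.
  split=> //; apply/integrableP; split.
    apply/measurable_EFinP; apply: (measurableT_comp (measurable_powR p)).
    exact: measurableT_comp.
  rewrite ltey; apply/eqP => Eoo; move: fu; rewrite Eoo.
  by rewrite poweRyr.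
move=> [mUu /integrableP[_ fu]]; apply/andP; split; apply/mem_set => /=.
  exact: (measurable_restrictT u mU).1.
by rewrite /finite_norm unlock E poweR_lty.
Qed.

Lemma measurable_enorm D (V : 'rV[R]_N -> 'rV[R]_N) :
  (forall i, measurable_fun D (fun x => V x ord0 i)) ->
  measurable_fun D (fun x => enorm (V x)).
Proof.
move=> mV; have ms : measurable_fun setT (@Num.sqrt R).
  by apply: continuous_measurable_fun; exact: sqrt_continuous.
apply: (measurableT_comp ms (g := fun x => dot (V x) (V x))).
by apply: measurable_sum => i; apply: measurable_funM.
Qed.

Lemma measurable_dot D (V W : 'rV[R]_N -> 'rV[R]_N) :
  (forall i, measurable_fun D (fun x => V x ord0 i)) ->
  (forall i, measurable_fun D (fun x => W x ord0 i)) ->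
  measurable_fun D (fun x => dot (V x) (W x)).
Proof. by move=> mV mW; apply: measurable_sum => i; apply: measurable_funM. Qed.

Lemma integrable_enorm_powR p U (V : 'rV[R]_N -> 'rV[R]_N) : 0 < p ->
  measurable U -> (forall i, Lp p U (fun x => V x ord0 i)) ->
  (forall i, measurable_fun U (fun x => V x ord0 i)) /\
  mu.-integrable U (EFin \o (fun x => enorm (V x) `^ p)).
Proof.
move=> p0 mU LV.
have mV i : measurable_fun U (fun x => V x ord0 i) by have /(Lp_powR _ p0 mU)[]
    := LV i.
split=> //.
have [C C0 HC] := powR_sum_le (index_enum 'I_N) (ltW p0).
have iS : mu.-integrable U (fun x => \sum_(i <- index_enum 'I_N) (EFin \o (fun
    x => `|V x ord0 i|%R `^ p)%R) x)%E.
  by apply: integrable_sum => // i _; have /(Lp_powR _ p0 mU)[] := LV i.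
have := integrableZl mU C iS; apply: le_integrable => //.
  apply/measurable_EFinP; apply: (measurableT_comp (measurable_powR p)).
  exact: measurable_enorm.
move=> x Ux; rewrite /= sumEFin -EFinM !abse_EFin lee_fin (ger0_norm (powR_ge0
    _ _)).
apply: le_trans (ler_norm _).
have := HC (fun i => `|V x ord0 i|) (fun i => normr_ge0 _).
rewrite powR0 ?gt_eqF// add0r => H; apply: le_trans H.
by rewrite ge0_ler_powR ?nnegrE ?enorm_ge0 ?sumr_ge0 ?(ltW p0)// enorm_le_sum.
Qed.

Lemma test_function_ball U phi : test_function U phi ->
  exists2 M : R, 0 < M & forall x, ~ ball 0 M x -> phi x = 0.
Proof.
move=> [_ /compact_bounded/bounded_set_ball[M M0 H] _]; exists M => // x xM.
have [//|/eqP p0] := pselect (phi x = 0); exfalso; apply/xM/H.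
exact: subset_closure.
Qed.

Lemma test_function_out U phi x : test_function U phi -> ~ U x ->
  phi x = 0 /\ grad phi x = 0.
Proof.
move=> [_ _ sU] Ux; have xs : ~ closure [set x | phi x != 0] x by move/sU.
have near0 : \forall y \near x, phi y = 0.
  have oC : open (~` closure [set x | phi x != 0]).
    by rewrite openC; exact: closed_closure.
  apply: filterS (open_nbhs_nbhs (conj oC xs)) => y ys.
  have [//|/eqP p0] := pselect (phi y = 0); exfalso; apply: ys.
  exact: subset_closure.
split; first exact: nbhs_singleton near0.
by apply/rowP => i; rewrite !mxE; exact: partial_eq0.
Qed.

Lemma test_functionS U phi psi : (forall n, C_n n psi) ->
  (forall x, psi x != 0 -> phi x != 0) -> test_function U phi ->
  test_function U psi.
Proof.
move=> Cpsi s [_ cK KU].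
have ss : closure [set x | psi x != 0] `<=` closure [set x | phi x != 0].
  by apply: closureS => x /=; exact: s.
split=> //; last exact: subset_trans KU.
by apply: subclosed_compact ss => //; exact: closed_closure.
Qed.

Lemma test_function_subset U V phi : U `<=` V ->
  test_function U phi -> test_function V phi.
Proof. by move=> UV [? ? KU]; split=> //; exact: subset_trans UV. Qed.

Lemma test_function_bounded U phi : test_function U phi ->
  exists2 B, 0 < B & forall x, `|phi x| <= B /\ enorm (grad phi x) <= B.
Proof.
move=> tp; have [Cphi _ _] := tp; have [M M0 phi0] := test_function_ball tp.
have [cphi _ Pphi] := Cphi 1.
have [B B0 HB] := compact_support_bounded cphi phi0.
have HBi i : exists Bi, forall x, `|partial i phi x| <= Bi.
  have [|Bi _ HBi] := @compact_support_bounded _ _ (partial i phi) (M + 1)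
      (Pphi i).
    move=> x /ball_complement_near xM; apply: partial_eq0.
    by apply: filterS xM => y; exact: phi0.
  by exists Bi.
have [b Hb] := choice HBi.
exists (B + `|\sum_i b i|) => [|x]; first by rewrite ltr_pwDl.
split; first by rewrite (le_trans (HB x))// lerDl.
apply: le_trans (enorm_le_sum _) _.
apply: (@le_trans _ _ (\sum_i b i)).
  by apply: ler_sum => i _; rewrite mxE; exact: Hb.
by rewrite (le_trans (ler_norm _))// lerDr ltW.
Qed.

Lemma measurable_grad phi (i : 'I_N) : (forall n, C_n n phi) ->
  measurable_fun setT (fun x => grad phi x ord0 i).
Proof.
move=> /(_ 1)[_ _ /(_ i) ci]; under eq_fun do rewrite mxE.
exact: continuous_measurable_row.
Qed.

Lemma test_function_Lp p U phi : 0 < p -> open U -> test_function U phi ->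
  Lp p U phi /\ forall i, Lp p U (fun x => grad phi x ord0 i).
Proof.
move=> p0 oU tp; have mU := open_measurable_row oU.
have [Cphi _ _] := tp; have [M M0 phi0] := test_function_ball tp.
have [B B0 HB] := test_function_bounded tp.
have key (h : 'rV[R]_N -> R) : measurable_fun setT h -> (forall x, `|h x| <=
    B) ->
    (forall x, ~ ball 0 (M + 1) x -> h x = 0) -> Lp p U h.
  move=> mh hB h0; apply/(Lp_powR _ p0 mU); split;
      first exact: measurable_funTS.
  apply: (@integrableS _ _ _ _ setT) => //.
  apply: (integrable_bounded_support (B := B `^ p) (M := M + 1)).
  - by apply: (measurableT_comp (measurable_powR p)); exact: measurableT_comp.
  - move=> x; rewrite ger0_norm ?powR_ge0//.
    by rewrite ge0_ler_powR ?nnegrE ?(ltW p0) ?(ltW B0).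
  - by move=> x /h0 ->; rewrite normr0 powR0// gt_eqF.
split=> [|i]; apply: key.
- exact: continuous_measurable_row (Cphi 0).
- by move=> x; have [] := HB x.
- move=> x xM; apply: phi0 => xM'; apply: xM; apply: le_ball xM';
    rewrite lerDl//.
- exact: measurable_grad.
- by move=> x; have [_] := HB x; apply: le_trans; exact: normr_coord_le.
- move=> x /ball_complement_near xM; rewrite mxE; apply: partial_eq0.
  by apply: filterS xM => y; exact: phi0.
Qed.

End sobolev_facts.

(** * Test functions as elements of W_0^{1,p} *)

Section test_functions_in_W01p.
Context {R : realType} {N : nat}.
Local Notation mu := (@lebesgue R N).
Implicit Types (U : set 'rV[R]_N) (u phi psi : 'rV[R]_N -> R) (p : R).

Lemma Rintegral_support U (h : 'rV[R]_N -> R) : (forall x, ~ U x -> h x = 0) ->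
  \int[mu]_(x in U) h x = \int[mu]_x h x.
Proof.
move=> h0; rewrite Rintegral_mkcond; congr (Rintegral _ _ _); apply/funext => x.
by rewrite patchE; case: ifPn => //; rewrite notin_setE => /h0 ->.
Qed.

(** The two integrals add up to the integral of the i-th partial derivative of the product, which is
    compactly supported. *)
Lemma test_function_weak_gradient U phi : test_function U phi ->
  weak_gradient U phi (grad phi).
Proof.
move=> tphi psi tpsi i.
have [Cphi _ _] := tphi; have [Cpsi _ _] := tpsi.
have [B B0 HB] := test_function_bounded tphi.
have [B' B'0 HB'] := test_function_bounded tpsi.
have [M M0 phi0] := test_function_ball tphi.
have [M' M'0 psi0] := test_function_ball tpsi.
rewrite (@Rintegral_support U (fun x => phi x * partial i psi x)); last first.
  by move=> x Ux; have [-> _] := test_function_out tphi Ux; rewrite mul0r.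
rewrite (@Rintegral_support U (fun x => grad phi x ord0 i * psi x)); last first.
  by move=> x Ux; have [-> _] := test_function_out tpsi Ux; rewrite mulr0.
have gradE h x : partial i h x = grad h x ord0 i by rewrite mxE.
have iF : mu.-integrable setT (EFin \o (fun x => phi x * partial i psi x)).
  apply: (integrable_bounded_support (B := B * B') (M := M)).
  - apply: measurable_funM; first exact: continuous_measurable_row (Cphi 0).
    by have [_ _ /(_ i)] := Cpsi 1; exact: continuous_measurable_row.
  - move=> x; rewrite normrM ler_pM//; first by have [] := HB x.
    by rewrite gradE (le_trans (normr_coord_le _ _))//; have [] := HB' x.
  - by move=> x /phi0 ->; rewrite mul0r.
have iG : mu.-integrable setT (EFin \o (fun x => grad phi x ord0 i * psi x)).
  apply: (integrable_bounded_support (B := B * B') (M := M')).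
  - apply: measurable_funM; first exact: measurable_grad.
    exact: continuous_measurable_row (Cpsi 0).
  - move=> x; rewrite normrM ler_pM//; last by have [] := HB' x.
    by rewrite (le_trans (normr_coord_le _ _))//; have [] := HB x.
  - by move=> x /psi0 ->; rewrite mulr0.
apply/eqP; rewrite -addr_eq0 -RintegralD//; apply/eqP.
have CM : C_n 1 (phi \* psi) by apply: C_nM.
have E : partial i (phi \* psi) = (fun x => phi x * partial i psi x + grad phi
    x ord0 i * psi x).
  apply/funext => x; have [_ Hv] := is_deriveM (C_n_is_derive i x (Cphi 1))
      (C_n_is_derive i x (Cpsi 1)).
  by rewrite {1}/partial Hv -gradE /GRing.scale/= [psi x * _]mulrC.
rewrite -[X in Rintegral _ _ X]E /Rintegral (@integral_partial_eq0 _ _ _ _ M)//.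
- by move=> x; have [] := C_n_is_derive i x CM.
- by case: CM => _ _ /(_ i).
- by move=> x /phi0 /= ->; rewrite mul0r.
Qed.

Lemma test_function_W01p p U phi : 0 < p -> open U -> test_function U phi ->
  W01p p U phi (grad phi).
Proof.
move=> p0 oU tp; have [L1 L2] := test_function_Lp p0 oU tp.
split; first by split=> //; exact: test_function_weak_gradient.
exists (fun=> phi); split=> //.
rewrite [X in X @ _ --> _](_ : _ = fun=> 0%E); first exact: cvg_cst.
apply/funext => k; apply: integral0_eq => x _.
by rewrite !subrr normr0 enorm0 powR0 ?gt_eqF// addr0.
Qed.

(** Norm convergence is upgraded, along a subsequence, to a.e. convergence together with one
    integrable majorant of the p-th powers of all errors. Every later passage from test functions to
    a Sobolev function is dominated convergence with this [S]. *)
Lemma W01p_approximation p U u Du : 0 < p -> open U -> W01p p U u Du ->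
  exists (phi : nat -> 'rV[R]_N -> R) (S : 'rV[R]_N -> R),
  [/\ forall k, test_function U (phi k), mu.-integrable U (EFin \o S),
   {ae mu, forall x, U x -> phi k x @[k --> \oo] --> u x /\
      enorm (Du x - grad (phi k) x) @[k --> \oo] --> 0} &
   {ae mu, forall x, U x -> forall k,
      `|u x - phi k x| `^ p + enorm (Du x - grad (phi k) x) `^ p <= S x}].
Proof.
move=> p0 oU [[Lu LDu _] [phi [tphi cphi]]]; have mU := open_measurable_row oU.
have [mu_ _] := (Lp_powR u p0 mU).1 Lu.
have [mDu _] := integrable_enorm_powR p0 mU LDu.
have [] := dominated_subsequence mU _ _ cphi.
- move=> k; have [Ck _ _] := tphi k.
  apply: measurable_funD; apply: (measurableT_comp (measurable_powR p)).
    apply: measurableT_comp => //; apply: measurable_funB => //.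
    by apply: measurable_funTS; exact: continuous_measurable_row (Ck 0).
  apply: measurable_enorm => i; under eq_fun do rewrite mxE [in X in _ + X]mxE.
  apply: measurable_funB => //; apply: measurable_funTS; exact: measurable_grad.
- by move=> k x; rewrite addr_ge0 ?powR_ge0.
move=> s [S [iS H]]; exists (phi \o s), S; split=> // [k||]; first exact: tphi;
    last first.
  by apply: filterS H => x H Ux; have [] := H Ux.
apply: filterS H => x H Ux; have [+ _] := H Ux => {}H.
have key (a : nat -> R) (b : nat -> R) : (forall k, 0 <= a k) -> (forall k,
    0 <= b k) ->
    a k `^ p + b k `^ p @[k --> \oo] --> 0 -> a k @[k --> \oo] --> 0.
  move=> a0 b0 /cvgr0Pnorm_lt ab; apply/cvgr0Pnorm_lt => e e0.
  have := ab (e `^ p) (powR_gt0 _ e0); apply: filterS => k.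
  rewrite !ger0_norm ?addr_ge0 ?powR_ge0// => abk.
  rewrite ltNge; apply/negP => ea; move: abk; rewrite ltNge => /negP; apply.
  rewrite (@le_trans _ _ (a k `^ p))// ?lerDl ?powR_ge0//.
  by rewrite ge0_ler_powR ?nnegrE ?(ltW p0) ?(ltW e0).
split.
  have /key := H; move=> /(_ (fun k => normr_ge0 _) (fun k => enorm_ge0 _)) Hn.
  apply/cvgrPdist_le => e e0; move/cvgr0Pnorm_le : Hn => /(_ e e0).
  by apply: filterS => k; rewrite normr_id.
move: H; under eq_fun do rewrite addrC; move/key; apply=> k;
    [exact: enorm_ge0|exact: normr_ge0].
Qed.

(** The function is [exp(-1/(r^2 - |x-c|^2))] inside a Euclidean ball and 0 outside. It is positive
    on a whole ball around [c], which has positive measure. It shows that the Rayleigh quotients on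
    a nonempty open set exist. *)
Lemma test_function_bump (U : set 'rV[R]_N) (c : 'rV[R]_N) : open U -> U c ->
  exists2 phi, test_function U phi & ~ ae_zero U phi.
Proof.
move=> oU Uc; have /nbhs_ballP[e /= e0 eU] := open_nbhs_nbhs (conj oU Uc).
(* Half of [e], because the closed Euclidean ball of radius [r] has to lie in the open sup-norm ball
   of radius [e]. *)
pose r := e / 2; have r0 : 0 < r by rewrite divr_gt0.
pose g (x : 'rV[R]_N) := r ^+ 2 - dot (x - c) (x - c).
have Cg n : C_n n g.
  have -> : g = cst (r ^+ 2) \+ (cst (-1) \* (fun x =>
      \sum_(i <- index_enum 'I_N)
      (x ord0 i - c ord0 i) * (x ord0 i - c ord0 i))).
    apply/funext => x; rewrite /g /= mulN1r; congr (_ - _).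
    by apply: eq_bigr => i _; rewrite !mxE.
  apply: C_nD; first exact: C_n_cst.
  apply: C_nM; first exact: C_n_cst.
  elim: (index_enum 'I_N) => [|i s IH].
    by under eq_fun do rewrite big_nil; exact: C_n_cst.
  under eq_fun do rewrite big_cons; apply: C_nD => //.
  have Ci : C_n n (fun x : 'rV[R]_N => x ord0 i - c ord0 i).
    by apply: C_nD; [exact: C_n_coord|exact: C_n_cst].
  exact: C_nM.
pose phi := exp_bump 0 \o g.
have phiE x : phi x != 0 = (0 < g x).
  rewrite /phi /= /exp_bump; case: ifPn => _; last by rewrite eqxx.
  by rewrite expr0 mul1r gt_eqF// expR_gt0.
have cg : continuous g by exact: (Cg 0).
have cG : closed [set x | 0 <= g x].
  exact: (closed_comp (fun x _ => cg x) (@closed_ge _ 0)).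
have GB : [set x | 0 <= g x] `<=` ball c e.
  move=> x /=; rewrite subr_ge0 -sqr_enorm ler_sqr ?nnegrE ?enorm_ge0 ?(ltW
      r0)// => xr.
  apply/row_ballP; split=> // i; rewrite distrC.
  have := normr_coord_le (x - c) i; rewrite !mxE => H.
  by apply: le_lt_trans H _; apply: le_lt_trans xr _; rewrite /r; lra.
have sG : closure [set x | phi x != 0] `<=` [set x | 0 <= g x].
  rewrite closureE => x; apply; split=> // y /=; rewrite phiE; exact: ltW.
exists phi.
  split; first by move=> n; exact: C_n_exp_bump.
    apply: (subclosed_compact _ _ sG); first exact: closed_closure.
    apply: bounded_closed_compact => //.
    exists (`|c| + e); split; first exact: num_real.
    move=> y cy x /GB; rewrite mx_norm_ball /ball_ /= => xc.
    apply: le_trans (ltW cy); rewrite -[x](subKr c) (le_trans (ler_normB _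
        _))//.
    by rewrite lerD2l ltW.
  by apply: subset_trans sG _; exact: subset_trans GB eU.
move=> [A [mA A0 sA]].
have gc : 0 < g c by rewrite /g subrr -sqr_enorm enorm0 expr0n/= subr0
    exprn_gt0.
have oG : open [set x | 0 < g x].
  exact: (open_comp (fun x _ => cg x) (@open_gt _ 0)).
have /nbhs_ballP[t /= t0 tG] := open_nbhs_nbhs (conj oG gc).
have /andP[+ _] := lebesgue_ball c t0; rewrite lt_neqAle => /andP[/negP + _];
    apply.
rewrite eq_sym eq_le measure_ge0 andbT -A0; apply: le_measure; rewrite ?inE//.
  exact: measurable_row_ball.
move=> x /tG gx; apply: sA => /= H.
have : phi x != 0 by rewrite phiE.
by rewrite H ?eqxx//; apply/eU/GB; exact: ltW.
Qed.

End test_functions_in_W01p.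

(** * Picone's inequality *)

Section picone_pointwise.
Context {R : realType}.
Implicit Types (p delta eps t s a b : R).

Lemma powR_sqr a q : 0 <= a -> (a ^+ 2) `^ q = a `^ (2 * q).
Proof. by move=> a0; rewrite -(powR_mulrn 2 a0) -powRrM. Qed.

(* A lower bound of [|u| / (u^2 + eps^2)^(1/2)] where [u <= - delta]. *)
Definition reg_ratio delta eps := delta / Num.sqrt (delta ^+ 2 + eps ^+ 2).

Lemma reg_ratio_gt0 delta eps : 0 < delta -> 0 < reg_ratio delta eps.
Proof.
by move=> d0; rewrite divr_gt0// sqrtr_gt0 ltr_wpDr ?sqr_ge0 ?exprn_gt0.
Qed.

Lemma reg_ratio_le1 delta eps : 0 < delta -> reg_ratio delta eps <= 1.
Proof.
move=> d0; rewrite ler_pdivrMr ?sqrtr_gt0 ?ltr_wpDr ?sqr_ge0 ?exprn_gt0// mul1r.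
by rewrite -{1}(gtr0_norm d0) -sqrtr_sqr ler_wsqrtr// lerDl sqr_ge0.
Qed.

Lemma reg_ratio_mono delta eps a : 0 < delta -> delta <= a ->
    reg_ratio delta eps <= reg_ratio a eps.
Proof.
move=> d0 da; have a0 := lt_le_trans d0 da.
have S0 b : 0 < b -> 0 < Num.sqrt (b ^+ 2 + eps ^+ 2).
  by move=> b0; rewrite sqrtr_gt0 ltr_wpDr ?sqr_ge0 ?exprn_gt0.
rewrite ler_pdivrMr ?S0// mulrAC ler_pdivlMr ?S0//.
rewrite -ler_sqr ?nnegrE ?mulr_ge0 ?sqrtr_ge0 ?(ltW d0) ?(ltW a0)//.
rewrite !exprMn !sqr_sqrtr ?addr_ge0 ?sqr_ge0// !mulrDr.
rewrite [a ^+ 2 * delta ^+ 2]mulrC lerD2l ler_wpM2r ?sqr_ge0// ler_sqr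
    ?nnegrE//; exact: ltW.
Qed.

(** Here [t], [s], [V], [W] stand for the values of [u], [phi], [Du], [grad phi], and the right side
    is the integrand of the p-Laplacian tested with the regularized Picone function. Its first part
    is at least [- p X^(p-1) |W|], and its second part is [(p-1) th X^p] up to the error due to
    [eps^p]; Young with weight [th] cancels the powers of [X]. *)
Lemma picone_pointwise N p delta eps t s (V W : 'rV[R]_N) :
  1 < p -> 0 < delta -> 0 < eps -> t <= - delta ->
  - ((p - 1) * (eps `^ p * delta `^ (- p)) * enorm V `^ p
     + reg_ratio delta eps `^ (1 - p) * enorm W `^ p) <=
  enorm V `^ (p - 2) *
    ((t ^+ 2 + eps ^+ 2) `^ (- (p - 1) / 2) *
       (p / 2 * (s ^+ 2 + eps ^+ 2) `^ (p / 2 - 1) * (2 * s) * dot V W)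
     + ((s ^+ 2 + eps ^+ 2) `^ (p / 2) - eps `^ p) *
       (- (p - 1) / 2 * (t ^+ 2 + eps ^+ 2) `^ (- (p - 1) / 2 - 1) * (2 * t)) *
           dot V V).
Proof.
move=> p1 d0 e0 td; set q := - (p - 1) / 2.
have pp : 0 < p by lra.
have pm : 0 < p - 1 by lra.
pose a := - t; have ad : delta <= a by rewrite /a; lra.
have a0 := lt_le_trans d0 ad.
pose th := reg_ratio a eps; have th0 : 0 < th := reg_ratio_gt0 eps a0.
have th1 : th <= 1 := reg_ratio_le1 eps a0.
pose h := Num.sqrt (a ^+ 2 + eps ^+ 2).
have hh : h ^+ 2 = t ^+ 2 + eps ^+ 2.
  by rewrite sqr_sqrtr ?addr_ge0 ?sqr_ge0// /a sqrrN.
have h0 : 0 < h by rewrite sqrtr_gt0 ltr_wpDr ?sqr_ge0 ?exprn_gt0.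
have thE : a = th * h by rewrite /th /reg_ratio divfK ?gt_eqF.
have dh : delta <= h.
  apply: le_trans ad _; rewrite -{1}(gtr0_norm a0) -sqrtr_sqr ler_wsqrtr//
      lerDl.
  exact: sqr_ge0.
pose k := Num.sqrt (s ^+ 2 + eps ^+ 2).
have kk : k ^+ 2 = s ^+ 2 + eps ^+ 2 by rewrite sqr_sqrtr ?addr_ge0 ?sqr_ge0.
have k0 : 0 < k by rewrite sqrtr_gt0 ltr_wpDl ?sqr_ge0 ?exprn_gt0.
have sk : `|s| <= k by rewrite -sqrtr_sqr ler_wsqrtr// lerDl sqr_ge0.
rewrite -hh -kk !powR_sqr ?(ltW h0) ?(ltW k0)//.
have -> : 2 * (p / 2 - 1) = p - 2 by field.
have -> : 2 * (p / 2) = p by field.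
have -> : 2 * q = 1 - p by rewrite /q; field.
have -> : 2 * (q - 1) = - p - 1 by rewrite /q; field.
rewrite -sqr_enorm.
have := cauchy_schwarz V W; have := enorm_ge0 V; have := enorm_ge0 W.
move: (enorm V) (enorm W) (dot V W) => v w d w0 v0 dvw.
have vE1 : v `^ (p - 2) * v = v `^ (p - 1).
  by rewrite -[RHS](@mulr_powRB1 _ v (p - 1))// [RHS]mulrC; congr (_ `^ _ * _);
      lra.
have vE2 : v `^ (p - 2) * v ^+ 2 = v `^ p.
  by rewrite expr2 mulrA vE1 mulrC mulr_powRB1.
have kE : k `^ (p - 2) * k = k `^ (p - 1).
  by rewrite -[RHS](@mulr_powRB1 _ k (p - 1)) ?(ltW k0)// [RHS]mulrC;
      congr (_ `^ _ * _); lra.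
have hE : h `^ (- p - 1) * h = h `^ (- p).
  rewrite -[X in _ * X](powRr1 (ltW h0)) -powRD; first by congr (_ `^ _); lra.
  by apply/implyP => _; rewrite gt_eqF.
(* The regularized form of [|phi| |Du| / |u|], the quantity to which Young's inequality is applied
   in Picone's argument. *)
pose X := v * k / h.
have X0 : 0 <= X by rewrite !mulr_ge0 ?invr_ge0// ltW.
have XE r : X `^ r = v `^ r * k `^ r * h `^ (- r).
  rewrite /X powRM ?mulr_ge0 ?invr_ge0 ?(ltW k0) ?(ltW h0)//.
  rewrite powRM ?(ltW k0)//; congr (_ * _).
  by rewrite -powR_inv1 ?(ltW h0)// -powRrM mulN1r.
have Y := young_weighted p1 th0 X0 w0.
have main : - (p * (X `^ (p - 1) * w)) <=
    h `^ (1 - p) * (p / 2 * k `^ (p - 2) * (2 * s) * (v `^ (p - 2) * d)).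
  apply: (@le_trans _ _ (- `|h `^ (1 - p) * (p / 2 * k `^ (p - 2) * (2 * s) *
      (v `^ (p - 2) * d))|)); last first.
    by rewrite lerNl; rewrite -normrN ler_norm.
  rewrite lerN2 !normrM !(ger0_norm (powR_ge0 _ _)) normfV !normr_nat
      (ger0_norm (ltW pp)).
  have -> : p * (X `^ (p - 1) * w) = h `^ (1 - p) * (p / 2 * k `^ (p - 2) * (2
      * k) * (v `^ (p - 2) * (v * w))).
    by rewrite XE -vE1 -kE opprB; field.
  rewrite ler_wpM2l ?powR_ge0// ler_pM ?mulr_ge0 ?powR_ge0 ?divr_ge0 ?(ltW
      pp)//.
    by rewrite ler_wpM2l ?mulr_ge0 ?powR_ge0 ?divr_ge0 ?(ltW pp)// ler_wpM2l.
  by rewrite ler_wpM2l ?powR_ge0.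
(* Since [t = - th * h] is negative, this term has the favourable sign; the subtracted part comes
   from [- eps^p] alone. *)
have second : v `^ (p - 2) * ((k `^ p - eps `^ p) * (q * h `^ (- p - 1) * (2 *
    t)) * v ^+ 2) =
    (p - 1) * (th * X `^ p) - (p - 1) * (th * (eps `^ p * v `^ p * h `^ (- p))).
  rewrite XE -vE2 -hE /q (_ : t = - (th * h)); last by rewrite -thE opprK.
  by field.
have b1 : th * (eps `^ p * v `^ p * h `^ (- p)) <=
    eps `^ p * delta `^ (- p) * v `^ p.
  rewrite [leRHS]mulrAC -[leRHS]mul1r ler_pM ?(ltW th0) ?mulr_ge0 ?powR_ge0//.
  rewrite ler_wpM2l ?mulr_ge0 ?powR_ge0// !powRN lef_pV2 ?posrE ?powR_gt0//.
  by rewrite ge0_ler_powR ?nnegrE ?(ltW pp) ?(ltW d0) ?(ltW h0).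
(* The exponent [1 - p] is negative, so the smallest ratio, attained at [|t| = delta], gives the
   largest factor. *)
have b2 : th `^ (1 - p) <= reg_ratio delta eps `^ (1 - p).
  rewrite -(opprB p 1) !powRN lef_pV2 ?posrE ?powR_gt0 ?reg_ratio_gt0//.
  by rewrite ge0_ler_powR ?nnegrE ?(ltW pm) ?(ltW th0) ?(ltW (reg_ratio_gt0 _
      d0))// reg_ratio_mono.
have b3 := ler_wpM2r (powR_ge0 w p) b2.
have b4 := ler_wpM2l (ltW pm) b1.
rewrite mulrDr second.
have -> : v `^ (p - 2) * (h `^ (1 - p) * (p / 2 * k `^ (p - 2) * (2 * s) * d)) =
  h `^ (1 - p) * (p / 2 * k `^ (p - 2) * (2 * s) * (v `^ (p - 2) * d)) by ring.
rewrite -[(p - 1) * (_ * _) * _]mulrA.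
move: main Y b3 b4; set A := h `^ _ * _; set B := p * _; set C :=
    (p - 1) * (th * X `^ p).
lra.
Qed.

(** The left side equals minus the (p-1)-th power of the ratio taken at [a = - t], so monotonicity
    of the ratio suffices. *)
Lemma reaction_pointwise p delta eps t : 1 < p -> 0 < delta -> t <= - delta ->
  `|t| `^ (p - 2) * t * (t ^+ 2 + eps ^+ 2) `^ (- (p - 1) / 2) <=
  - reg_ratio delta eps `^ (p - 1).
Proof.
move=> p1 d0 td.
have pm : 0 < p - 1 by lra.
pose a := - t; have ad : delta <= a by rewrite /a; lra.
have a0 := lt_le_trans d0 ad.
have -> : `|t| = a by rewrite ltr0_norm// /a -oppr_gt0.
have -> : t = - a by rewrite opprK.
pose h := Num.sqrt (a ^+ 2 + eps ^+ 2).
have h0 : 0 < h by rewrite sqrtr_gt0 ltr_wpDr ?sqr_ge0 ?exprn_gt0.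
have hh : h ^+ 2 = a ^+ 2 + eps ^+ 2 by rewrite sqr_sqrtr ?addr_ge0 ?sqr_ge0.
rewrite sqrrN -hh powR_sqr ?(ltW h0)//.
rewrite mulrN mulNr lerN2.
have -> : a `^ (p - 2) * a = a `^ (p - 1).
  by rewrite -[RHS](@mulr_powRB1 _ a (p - 1)) ?(ltW a0)// [RHS]mulrC;
      congr (_ `^ _ * _); lra.
have -> : 2 * (- (p - 1) / 2) = -1 * (p - 1) by field.
rewrite powRrM -powRM ?powR_ge0 ?(ltW a0)// powR_inv1 ?(ltW h0)//.
by rewrite ge0_ler_powR ?nnegrE ?(ltW pm) ?(ltW (reg_ratio_gt0 _ _))//
    reg_ratio_mono.
Qed.

End picone_pointwise.

(** * Integrals of real-valued functions compared almost everywhere *)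

Section real_integrable.
Context d (T : measurableType d) (R : realType).
Variables (mu : {measure set T -> \bar R}) (D : set T) (mD : measurable D).
Implicit Types f g : T -> R.

Lemma integrable_add f g : mu.-integrable D (EFin \o f) ->
  mu.-integrable D (EFin \o g) -> mu.-integrable D (EFin \o (fun x =>
      f x + g x)).
Proof. by move=> fi gi; have := integrableD mD fi gi. Qed.

Lemma integrable_scale (c : R) f : mu.-integrable D (EFin \o f) ->
  mu.-integrable D (EFin \o (fun x => c * f x)).
Proof. by move=> fi; have := integrableZl mD c fi. Qed.

Lemma integrable_const (c : R) : (mu D < +oo)%E ->
  mu.-integrable D (EFin \o (fun=> c)).
Proof.
move=> muD; apply: measurable_bounded_integrable => //.
by exists `|c|; split; [exact: num_real|move=> y cy x _ /=; exact: ltW].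
Qed.

Lemma measurable_integrable f : mu.-integrable D (EFin \o f) ->
    measurable_fun D f.
Proof. by move=> /integrableP[/measurable_EFinP]. Qed.

Lemma ae_le_Rintegral f g : mu.-integrable D (EFin \o f) ->
  mu.-integrable D (EFin \o g) -> {ae mu, forall x, D x -> f x <= g x} ->
  \int[mu]_(x in D) f x <= \int[mu]_(x in D) g x.
Proof.
move=> fi gi fg; rewrite -subr_ge0 -RintegralB//.
have mf := measurable_integrable fi; have mg := measurable_integrable gi.
have mh : measurable_fun D (fun x => g x - f x) by exact: measurable_funB.
(* Passing to the absolute value turns nonnegativity almost everywhere into nonnegativity
   everywhere. *)
rewrite /Rintegral (@ae_eq_integral _ _ _ mu D (fun x => `|g x - f x|%:E))//.
- by apply: fine_ge0; apply: integral_ge0 => x _; rewrite lee_fin.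
- exact/measurable_EFinP.
- by apply/measurable_EFinP; exact: (measurableT_comp (@normr_measurable _
    setT) mh).
- by apply: filterS fg => x H Dx; rewrite ger0_norm// subr_ge0 H.
Qed.

Lemma ae_zero_Rintegral f : measurable_fun D f ->
  {ae mu, forall x, D x -> f x = 0} -> \int[mu]_(x in D) f x = 0.
Proof.
move=> mf f0; rewrite /Rintegral (@ae_eq_integral _ _ _ mu D (fun=> 0%E))//.
- by rewrite integral0.
- exact/measurable_EFinP.
- by apply: filterS f0 => x H Dx; rewrite H.
Qed.

End real_integrable.

(** * Derivatives and bounds of the regularized power *)

Section regularized_power.
Context {R : realType} {N : nat}.
Implicit Types (p q eps t v e : R) (g phi : 'rV[R]_N -> R).

(** A smooth substitute for [|t|^(2q)]; for nonzero [eps] the base stays at least [eps^2], so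
    negative [q] is allowed. *)
Definition reg_powR eps q t := (t ^+ 2 + eps ^+ 2) `^ q.

Lemma reg_powR_base_gt0 eps t : 0 < eps -> 0 < t ^+ 2 + eps ^+ 2.
Proof. by move=> e0; rewrite ltr_wpDl ?sqr_ge0 ?exprn_gt0. Qed.

Lemma C_n_reg_powR eps q g : 0 < eps -> (forall n, C_n n g) ->
  forall n, C_n n (reg_powR eps q \o g).
Proof.
move=> e0 Cg n; apply: C_n_powR => [|x]; last exact: reg_powR_base_gt0.
apply: C_nD; last exact: C_n_cst.
rewrite (_ : (fun x => g x ^+ 2) = g \* g); first exact: C_nM.
by apply/funext => x; rewrite /= expr2.
Qed.

Lemma grad_reg_powR eps q g x : 0 < eps -> (forall n, C_n n g) ->
  grad (reg_powR eps q \o g) x =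
  (q * (g x ^+ 2 + eps ^+ 2) `^ (q - 1) * (2 * g x)) *: grad g x.
Proof.
move=> e0 Cg; apply/rowP => i; rewrite !mxE.
have Hg := C_n_is_derive i x (Cg 1).
have H2 : is_derive x (delta_mx 0 i) (fun y =>
    g y ^+ 2 + eps ^+ 2) (2 * g x * partial i g x).
  rewrite (_ : (fun y => g y ^+ 2 + eps ^+ 2) = g ^+ 2 + cst (eps ^+ 2));
      last first.
    by apply/funext => y; rewrite !expr2.
  apply: is_derive_eq (is_deriveD (is_deriveX 2 Hg) (is_derive_cst _ _ _)) _.
  by rewrite addr0 /GRing.scale/= expr1.
have [_ H] := @is_derive_chain _ _ (fun y : R => y `^ q)
  (fun y => g y ^+ 2 + eps ^+ 2) _ _ _ _
  (is_derive1_powR q (reg_powR_base_gt0 (g x) e0)) H2.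
by rewrite /partial (_ : reg_powR eps q \o g = (fun y : R => y `^ q) \o
  (fun y => g y ^+ 2 + eps ^+ 2))// H !mulrA.
Qed.

Lemma grad_mul g phi x : (forall n, C_n n g) -> (forall n, C_n n phi) ->
  grad (g \* phi) x = phi x *: grad g x + g x *: grad phi x.
Proof.
move=> Cg Cphi; apply/rowP => i; rewrite !mxE.
have [_ H] := is_deriveM (C_n_is_derive i x (Cg 1)) (C_n_is_derive i x (Cphi
    1)).
by rewrite /partial H addrC.
Qed.

Lemma grad_addc g (c : R) x : (forall n, C_n n g) ->
  grad (g \+ cst c) x = grad g x.
Proof.
move=> Cg; apply/rowP => i; rewrite !mxE.
have [_ H] := is_deriveD (C_n_is_derive i x (Cg 1)) (is_derive_cst c x
    (delta_mx 0 i)).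
by rewrite /partial H addr0.
Qed.

Lemma continuous_reg_powR eps q : 0 < eps -> continuous (reg_powR eps q).
Proof.
move=> e0 t; apply: (@continuous_comp _ _ _ (fun t : R =>
    t ^+ 2 + eps ^+ 2) (fun y : R => y `^ q)).
  apply: continuousD; last exact: cst_continuous.
  exact: exprn_continuous.
apply: differentiable_continuous; apply/derivable1_diffP.
by have [] := is_derive1_powR q (reg_powR_base_gt0 t e0).
Qed.

Lemma reg_powR_le eps q t : 0 < eps -> q <= 0 -> reg_powR eps q t <=
    (eps ^+ 2) `^ q.
Proof.
move=> e0 q0; rewrite /reg_powR -(opprK q) 2!(powRN _ (- q)).
have e2 : 0 < eps ^+ 2 by rewrite exprn_gt0.
have b0 := reg_powR_base_gt0 t e0.
rewrite lef_pV2 ?posrE ?powR_gt0//.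
by rewrite ge0_ler_powR ?nnegrE ?oppr_ge0 ?(ltW e2) ?(ltW b0)// lerDr sqr_ge0.
Qed.

(** From [|2t| <= 1 + t^2 <= (1 + eps^(-2)) (t^2 + eps^2)] the exponent returns to [q <= 0]. The
    bound is global in [t] because the approximants substituted for [t] are not uniformly
    bounded. *)
Lemma reg_powR_deriv_bounded eps q : 0 < eps -> q <= 0 ->
  exists2 C, 0 <= C & forall t,
    `|q * (t ^+ 2 + eps ^+ 2) `^ (q - 1) * (2 * t)| <= C.
Proof.
move=> e0 q0; have e2 : 0 < eps ^+ 2 by rewrite exprn_gt0.
exists (- q * ((1 + (eps ^+ 2)^-1) * (eps ^+ 2) `^ q)) => [|t].
  by rewrite mulr_ge0 ?oppr_ge0// mulr_ge0 ?powR_ge0// addr_ge0// invr_ge0 ltW.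
have b0 := reg_powR_base_gt0 t e0.
rewrite -mulrA normrM (ler0_norm q0) ler_wpM2l ?oppr_ge0//.
rewrite normrM (ger0_norm (powR_ge0 _ _)).
apply: (@le_trans _ _ ((t ^+ 2 + eps ^+ 2) `^ (q - 1) * ((1 + (eps ^+ 2)^-1) *
    (t ^+ 2 + eps ^+ 2)))).
  rewrite ler_wpM2l ?powR_ge0//.
  have -> : (1 + (eps ^+ 2)^-1) * (t ^+ 2 + eps ^+ 2) =
      t ^+ 2 + eps ^+ 2 + ((eps ^+ 2)^-1 * t ^+ 2 + 1) by field; rewrite gt_eqF.
  have h1 : 0 <= (eps ^+ 2)^-1 * t ^+ 2 by rewrite mulr_ge0 ?sqr_ge0// invr_ge0
      ltW.
  have h2 : `|2 * t| <= 1 + t ^+ 2.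
    rewrite ler_norml; apply/andP; split; have := sqr_ge0 (t + 1); have :=
        sqr_ge0 (t - 1); rewrite !sqrrD; lra.
  apply: le_trans h2 _; lra.
rewrite mulrCA ler_wpM2l ?addr_ge0 ?invr_ge0 ?(ltW e2)//.
apply: le_trans (reg_powR_le t e0 q0); rewrite /reg_powR mulrC.
rewrite le_eqVlt; apply/orP; left; apply/eqP.
rewrite -[X in X * _](powRr1 (ltW b0)) -powRD; first by congr (_ `^ _); lra.
by apply/implyP => _; rewrite gt_eqF.
Qed.

Lemma powR_sub1_le p v : 1 < p -> 0 <= v -> v `^ (p - 1) <= 1 + v `^ p.
Proof.
move=> p1 v0; have [v1|v1] := leP v 1.
  apply: (@le_trans _ _ (1 `^ (p - 1))); last by rewrite powR1 lerDl powR_ge0.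
  by rewrite ge0_ler_powR ?nnegrE//; lra.
apply: (@le_trans _ _ (v `^ p)); last by rewrite lerDr.
by rewrite ler_powR ?(ltW v1)//; lra.
Qed.

(** A Young inequality with constants 1: the larger of [v] and [e] replaces the other. It dominates
    [|Du|^(p-1) |Du - grad phi_k|]. *)
Lemma powR_sub1_mul_le p v e : 1 < p -> 0 <= v -> 0 <= e ->
  v `^ (p - 1) * e <= v `^ p + e `^ p.
Proof.
move=> p1 v0 e0; have [ev|ve] := leP e v.
  apply: (@le_trans _ _ (v `^ p)); last by rewrite lerDl powR_ge0.
  by rewrite mulrC -(@mulr_powRB1 _ v p)// ?ler_wpM2r ?powR_ge0//; lra.
apply: (@le_trans _ _ (e `^ p)); last by rewrite lerDr powR_ge0.
rewrite mulrC -(@mulr_powRB1 _ e p)//; last lra.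
by rewrite ler_wpM2l// ge0_ler_powR ?nnegrE ?(ltW ve)//; lra.
Qed.

(** Both sides are 0 at [v = 0], even when [p < 2], so the zeros of [u] and [Du] need no separate
    treatment. *)
Lemma powR_sub2_mul p v : 1 < p -> 0 <= v -> v `^ (p - 2) * v = v `^ (p - 1).
Proof.
move=> p1 v0; rewrite -[RHS](@mulr_powRB1 _ v (p - 1))//; last lra.
by rewrite [RHS]mulrC; congr (_ `^ _ * _); lra.
Qed.

End regularized_power.

(** * The weak equation tested with the regularized Picone function *)

Section picone_integral.
Context {R : realType} {N : nat}.
Local Notation mu := (@lebesgue R N).
Variables (p a eps : R) (Omega : set 'rV[R]_N) (f u : 'rV[R]_N -> R)
  (Du : 'rV[R]_N -> 'rV[R]_N) (phi : 'rV[R]_N -> R).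
Hypotheses (p1 : 1 < p) (e0 : 0 < eps) (oO : open Omega)
  (Ofin : (mu Omega < +oo)%E) (mf : measurable_fun Omega f)
  (Wu : W01p p Omega u Du)
  (weq : forall xi Dxi, W01p p Omega xi Dxi ->
    \int[mu]_(x in Omega) (enorm (Du x) `^ (p - 2) * dot (Du x) (Dxi x)) =
    a * \int[mu]_(x in Omega) (`|u x| `^ (p - 2) * u x * xi x)
    + \int[mu]_(x in Omega) (f x * xi x))
  (tphi : test_function Omega phi)
  (fphi : {ae mu, forall x, Omega x -> phi x != 0 -> f x = 0}).

Let p0 : 0 < p. Proof. by rewrite (lt_trans _ p1). Qed.
Let mO : measurable Omega. Proof. exact: open_measurable_row. Qed.
Let mu_ : measurable_fun Omega u.
Proof. by have [[/(Lp_powR _ p0 mO)[]]] := Wu. Qed.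
Let iu : mu.-integrable Omega (EFin \o (fun x => `|u x| `^ p)).
Proof. by have [[/(Lp_powR _ p0 mO)[]]] := Wu. Qed.
Let mDu i : measurable_fun Omega (fun x => Du x ord0 i).
Proof. by have [[_ /(integrable_enorm_powR p0 mO)[]]] := Wu. Qed.
Let iDu : mu.-integrable Omega (EFin \o (fun x => enorm (Du x) `^ p)).
Proof. by have [[_ /(integrable_enorm_powR p0 mO)[]]] := Wu. Qed.

(* Unlike [|phi|^p], this is smooth; its support is contained in that of
   [phi]. *)
Definition smoothed_power : 'rV[R]_N -> R := (reg_powR eps (p / 2) \o phi) \+
    cst (- eps `^ p).

(** [G] regularizes [|t|^(1-p)] and [dG] is its derivative. *)
Let q := - (p - 1) / 2.
Let q0 : q <= 0. Proof. by rewrite /q; move: p1; lra. Qed.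
Let G := reg_powR eps q.
Let dG (t : R) := q * (t ^+ 2 + eps ^+ 2) `^ (q - 1) * (2 * t).

Let Cphi n : C_n n phi. Proof. by have [] := tphi. Qed.

Lemma C_n_smoothed_power n : C_n n smoothed_power.
Proof. by apply: C_nD; [exact: C_n_reg_powR|exact: C_n_cst]. Qed.

Lemma grad_smoothed_power x : grad smoothed_power x =
  (p / 2 * (phi x ^+ 2 + eps ^+ 2) `^ (p / 2 - 1) * (2 * phi x)) *: grad phi x.
Proof.
rewrite /smoothed_power grad_addc; first exact: grad_reg_powR.
by move=> n; exact: C_n_reg_powR.
Qed.

Lemma smoothed_power_eq0 x : phi x = 0 -> smoothed_power x = 0.
Proof.
move=> phi0; rewrite /smoothed_power /= phi0 /reg_powR expr0n/= add0r powR_sqr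
    ?ltW//.
by rewrite mulrC divfK ?subrr.
Qed.

Lemma test_function_smoothed_power_mul g : (forall n, C_n n g) ->
  test_function Omega (smoothed_power \* g).
Proof.
move=> Cg; apply: (test_functionS _ _ tphi) => [n|x];
    first exact: (C_nM (C_n_smoothed_power n) (Cg n)).
by apply: contra => /eqP/smoothed_power_eq0 /= ->; rewrite mul0r.
Qed.

Lemma test_function_smoothed_power : test_function Omega smoothed_power.
Proof.
apply: (test_functionS _ _ tphi) => [n|x]; first exact: C_n_smoothed_power.
by apply: contra => /eqP/smoothed_power_eq0 ->.
Qed.

(* Obtained by testing with [smoothed_power * G (phik k)] and letting
   [k -> oo]; admissibility of the limit [smoothed_power * G u] as a test
   function is not needed. *)
Lemma picone_identity :
  let F x := enorm (Du x) `^ (p - 2) *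
    (G (u x) * dot (Du x) (grad smoothed_power x) + smoothed_power x * dG (u x)
        * dot (Du x) (Du x)) in
  let H x := `|u x| `^ (p - 2) * u x * (smoothed_power x * G (u x)) in
  [/\ mu.-integrable Omega (EFin \o F), mu.-integrable Omega (EFin \o H) &
    \int[mu]_(x in Omega) F x = a * \int[mu]_(x in Omega) H x].
Proof.
move=> F H.
have [phik [S [tk iS cvk domk]]] := W01p_approximation p0 oO Wu.
pose xi k := smoothed_power \* (G \o phik k).
have Ck k n : C_n n (phik k) by have [] := tk k.
have txi k : test_function Omega (xi k).
  by apply: test_function_smoothed_power_mul => n; exact: C_n_reg_powR.
have gxi k x : grad (xi k) x = G (phik k x) *: grad smoothed_power x
    + (smoothed_power x * dG (phik k x)) *: grad (phik k) x.
  rewrite /xi grad_mul; [|exact: C_n_smoothed_power|by move=> n;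
      exact: C_n_reg_powR].
  by rewrite /G grad_reg_powR// scalerA.
pose Fk k x := enorm (Du x) `^ (p - 2) * (G (phik k x) * dot (Du x) (grad
    smoothed_power x)
    + smoothed_power x * dG (phik k x) * dot (Du x) (grad (phik k) x)).
pose Hk k x := `|u x| `^ (p - 2) * u x * (smoothed_power x * G (phik k x)).
(* The source term drops out: [xi k] is 0 where [phi] is, and [f] is 0 almost everywhere else. *)
have eqk k : \int[mu]_(x in Omega) Fk k x = a * \int[mu]_(x in Omega) Hk k x.
  have -> : Fk k = fun x => enorm (Du x) `^ (p - 2) * dot (Du x) (grad (xi k)
      x).
    by apply/funext => x; rewrite /Fk gxi dotDr !dotZr.
  rewrite (weq (test_function_W01p p0 oO (txi k))) [X in _ +
      X]ae_zero_Rintegral ?addr0//.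
    apply: measurable_funM => //; apply: measurable_funTS.
    by have [C _ _] := txi k; exact: continuous_measurable_row (C 0).
  apply: filterS fphi => x Hx Ox; have [p00|/eqP pn0] := pselect (phi x = 0).
    by rewrite /xi /= smoothed_power_eq0// mul0r mulr0.
  by rewrite Hx// mul0r.
have [B B0 HB] := test_function_bounded test_function_smoothed_power.
have [c1 c10 Hc1] := reg_powR_deriv_bounded e0 q0.
pose c0 := (eps ^+ 2) `^ q; have c00 : 0 <= c0 by exact: powR_ge0.
have Gc0 t : `|G t| <= c0 by rewrite ger0_norm ?powR_ge0// reg_powR_le.
have mG : measurable_fun setT G by apply: continuous_measurable_fun;
    exact: continuous_reg_powR.
have cdG : continuous dG.
  have cr : continuous (reg_powR eps (q - 1)) by exact: continuous_reg_powR.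
  move=> t; apply: cvgM; first by apply: cvgMl_tmp; exact: cr.
  by apply: cvgMl_tmp; exact: cvg_id.
have mdG : measurable_fun setT dG by exact: continuous_measurable_fun.
have mPsi : measurable_fun Omega smoothed_power.
  by apply: measurable_funTS; exact: continuous_measurable_row
      (C_n_smoothed_power 0).
have mgPsi i : measurable_fun Omega (fun x => grad smoothed_power x ord0 i).
  by apply: measurable_funTS; apply: measurable_grad; exact: C_n_smoothed_power.
have mphik k : measurable_fun Omega (phik k).
  by apply: measurable_funTS; exact: continuous_measurable_row (Ck k 0).
have mgphik k i : measurable_fun Omega (fun x => grad (phik k) x ord0 i).
  by apply: measurable_funTS; apply: measurable_grad; exact: Ck.
have mpow r : measurable_fun Omega (fun x => enorm (Du x) `^ r).
  by apply: (measurableT_comp (measurable_powR r)); exact: measurable_enorm.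
have mFgen (w : 'rV[R]_N -> R) (W : 'rV[R]_N ->
    'rV[R]_N) : measurable_fun Omega w ->
    (forall i, measurable_fun Omega (fun x => W x ord0 i)) ->
    measurable_fun Omega (fun x => enorm (Du x) `^ (p - 2) *
      (G (w x) * dot (Du x) (grad smoothed_power x) + smoothed_power x * dG (w
          x) * dot (Du x) (W x))).
  move=> mw mW; apply: measurable_funM => //; apply: measurable_funD.
    by apply: measurable_funM; [exact: (measurableT_comp mG mw)|exact:
        measurable_dot].
  apply: measurable_funM; last exact: measurable_dot.
  by apply: measurable_funM => //; exact: (measurableT_comp mdG mw).
have mHgen (w : 'rV[R]_N -> R) : measurable_fun Omega w ->
    measurable_fun Omega (fun x => `|u x| `^ (p - 2) * u x * (smoothed_power x
        * G (w x))).
  move=> mw; apply: measurable_funM.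
    apply: measurable_funM => //; apply: (measurableT_comp (measurable_powR (p
        - 2))).
    exact: (measurableT_comp (@normr_measurable _ setT) mu_).
  by apply: measurable_funM => //; exact: (measurableT_comp mG mw).
have cphik : {ae mu, forall x, Omega x -> G (phik k x) @[k --> \oo] -->
    G (u x) /\
    dG (phik k x) @[k --> \oo] --> dG (u x)}.
  apply: filterS cvk => x Hx Ox; have [c _] := Hx Ox; split.
    by apply: (cvg_comp _ _ c); exact: continuous_reg_powR.
  by apply: (cvg_comp _ _ c); exact: cdG.
have cF : {ae mu, forall x, Omega x -> Fk ^~ x @ \oo --> F x}.
  apply: filterS2 cvk cphik => x Hx Hx' Ox; have [_ ce] := Hx Ox;
      have [cg cdg] := Hx' Ox.
  apply: cvgMl_tmp; apply: cvgD; first exact: cvgMr_tmp.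
  apply: cvgM; first exact: cvgMl_tmp.
  apply/cvgrPdist_le => e egt0.
  have ce' : enorm (Du x) * enorm (Du x - grad (phik k) x) @[k --> \oo] -->
      (0 : R).
    by rewrite -(mulr0 (enorm (Du x))); exact: cvgMl_tmp.
  move/cvgr0Pnorm_le : ce' => /(_ e egt0); apply: filterS => k.
  rewrite ger0_norm ?mulr_ge0 ?enorm_ge0//; apply: le_trans.
  have -> : dot (Du x) (Du x) - dot (Du x) (grad (phik k) x) = dot (Du x) (Du x
      - grad (phik k) x).
    by rewrite dotDr; congr (_ + _); rewrite -[- grad _ _]scaleN1r dotZr mulN1r.
  exact: cauchy_schwarz.
have cH : {ae mu, forall x, Omega x -> Hk ^~ x @ \oo --> H x}.
  apply: filterS cphik => x Hx Ox; have [cg _] := Hx Ox.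
  by apply: cvgMl_tmp; exact: cvgMl_tmp.
(* [c0], [c1] bound [G], [dG], and [B] bounds [smoothed_power] and its gradient. With [v = |Du|] and
   [e = |Du - grad phi_k|] one has [|grad phi_k| <= v + e], so it remains to use
   [v^(p-1) <= 1 + v^p], [v^(p-1) (v + e) <= 2 v^p + e^p] and [e^p <= S]. The constant 1 is
   integrable as [Omega] has finite measure. *)
pose SF x := c0 * B * (1 + enorm (Du x) `^ p) + B * c1 * (2 * enorm (Du x) `^ p
    + S x).
have iSF : mu.-integrable Omega (EFin \o SF).
  have i1 := integrable_const mO 1 Ofin.
  apply: integrable_add => //; apply: integrable_scale => //;
      apply: integrable_add => //.
  exact: integrable_scale.
pose SH x := c0 * B * (1 + `|u x| `^ p).
have iSH : mu.-integrable Omega (EFin \o SH).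
  by apply: integrable_scale => //; apply: integrable_add => //;
      exact: integrable_const.
have dF : {ae mu, forall x, Omega x -> forall k, `|Fk k x| <= SF x}.
  apply: filterS domk => x Hx Ox k; have := Hx Ox k => HS.
  have Pow : enorm (Du x - grad (phik k) x) `^ p <= S x.
    by apply: le_trans HS; rewrite lerDr powR_ge0.
  set v := enorm (Du x); set e := enorm (Du x - grad (phik k) x).
  have v0 : 0 <= v by exact: enorm_ge0.
  have e00 : 0 <= e by exact: enorm_ge0.
  have [PB gPB] := HB x.
  have d1 : `|dot (Du x) (grad smoothed_power x)| <= v * B.
    by apply: le_trans (cauchy_schwarz _ _) _; rewrite ler_wpM2l.
  have d2 : `|dot (Du x) (grad (phik k) x)| <= v * (v + e).
    apply: le_trans (cauchy_schwarz _ _) _; rewrite ler_wpM2l//.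
    rewrite -[grad _ _](subKr (Du x)); apply: le_trans (enorm_triangle _ _) _.
    by rewrite enormN.
  rewrite /Fk normrM (ger0_norm (powR_ge0 _ _)) -/v.
  apply: (@le_trans _ _ (v `^ (p - 2) * (c0 * (v * B) + B * c1 * (v * (v +
      e))))).
    rewrite ler_wpM2l ?powR_ge0//; apply: le_trans (ler_normD _ _) _;
        apply: lerD.
      by rewrite normrM ler_pM.
    by rewrite normrM ler_pM// normrM ler_pM//; exact: Hc1.
  have -> : v `^ (p - 2) * (c0 * (v * B) + B * c1 * (v * (v + e))) =
      c0 * B * (v `^ (p - 2) * v) + B * c1 * (v * (v `^ (p - 2) * v) + v `^ (p
          - 2) * v * e).
    by ring.
  rewrite powR_sub2_mul// mulr_powRB1// /SF -/v; apply: lerD.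
    by rewrite ler_wpM2l ?mulr_ge0 ?(ltW B0)// powR_sub1_le.
  rewrite ler_wpM2l ?mulr_ge0 ?(ltW B0)//.
  by have := powR_sub1_mul_le p1 v0 e00; move: Pow; rewrite -/e; lra.
have dH : {ae mu, forall x, Omega x -> forall k, `|Hk k x| <= SH x}.
  apply: nearW => x Ox k; have [PB _] := HB x.
  rewrite /Hk !normrM (ger0_norm (powR_ge0 _ _)) powR_sub2_mul// mulrC /SH.
  rewrite ler_pM ?mulr_ge0 ?powR_ge0//; last exact: powR_sub1_le.
  by rewrite mulrC ler_pM.
have [iF cvF] := dominated_Rintegral mO (fun k =>
    mFgen _ _ (mphik k) (mgphik k))
  (mFgen _ _ mu_ (fun i => mDu i)) cF iSF dF.
have [iH cvH] := dominated_Rintegral mO (fun k =>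
    mHgen _ (mphik k)) (mHgen _ mu_) cH iSH dH.
split=> //.
have cvaH : a * \int[mu]_(x in Omega) Hk k x @[k --> \oo] -->
    a * \int[mu]_(x in Omega) H x.
  exact: cvgMl_tmp cvH.
have E : (fun k => \int[mu]_(x in Omega) Fk k x) =
    (fun k => a * \int[mu]_(x in Omega) Hk k x) by apply/funext => k;
        exact: eqk.
move: cvF; rewrite E => cvF.
by rewrite -(cvg_lim (@Rhausdorff R) cvF) (cvg_lim (@Rhausdorff R) cvaH).
Qed.

End picone_integral.

(** * From the regularized inequality to Rayleigh quotients *)

Section picone_inequality.
Context {R : realType} {N : nat}.
Local Notation mu := (@lebesgue R N).

Lemma test_function_integrable_powR p U (phi : 'rV[R]_N -> R) : 0 < p ->
    open U ->
  test_function U phi ->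
  mu.-integrable U (EFin \o (fun x => `|phi x| `^ p)) /\
  mu.-integrable U (EFin \o (fun x => enorm (grad phi x) `^ p)).
Proof.
move=> p0 oU tphi; have mU := open_measurable_row oU.
have [/(Lp_powR _ p0 mU)[_ i1] /(integrable_enorm_powR p0 mU)[_ i2]] :=
    test_function_Lp p0 oU tphi.
by split.
Qed.

(** The two pointwise bounds are integrated and compared through [picone_identity]. The term with
    the measure of [Omega] arises from [|phi|^p - eps^p <= smoothed_power]. *)
Lemma picone_regularized (p a eps delta : R) (Omega : set 'rV[R]_N)
    (f u : 'rV[R]_N -> R) (Du : 'rV[R]_N -> 'rV[R]_N) (phi : 'rV[R]_N -> R) :
  1 < p -> 0 <= a -> 0 < eps -> 0 < delta -> open Omega -> (mu Omega < +oo)%E ->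
  measurable_fun Omega f -> W01p p Omega u Du ->
  (forall xi Dxi, W01p p Omega xi Dxi ->
    \int[mu]_(x in Omega) (enorm (Du x) `^ (p - 2) * dot (Du x) (Dxi x)) =
    a * \int[mu]_(x in Omega) (`|u x| `^ (p - 2) * u x * xi x)
    + \int[mu]_(x in Omega) (f x * xi x)) ->
  test_function Omega phi ->
  {ae mu, forall x, Omega x -> phi x != 0 -> f x = 0} ->
  {ae mu, forall x, Omega x -> phi x != 0 -> u x <= - delta} ->
  a * (reg_ratio delta eps `^ (p - 1) *
    (\int[mu]_(x in Omega) (`|phi x| `^ p) + - eps `^ p * fine (mu Omega))) <=
  (p - 1) * (eps `^ p * delta `^ (- p)) * \int[mu]_(x in Omega) (enorm (Du x)
      `^ p)
  + reg_ratio delta eps `^ (1 - p) * \int[mu]_(x in Omega) (enorm (grad phi x)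
      `^ p).
Proof.
move=> p1 a0 e0 d0 oO Ofin mf Wu weq tphi fphi uphi.
have p0 : 0 < p by rewrite (lt_trans _ p1).
have mO := open_measurable_row oO.
have [iF iH] := picone_identity p1 e0 oO Ofin mf Wu weq tphi fphi.
set F := (X in Rintegral mu Omega X = _); set H :=
    (X in _ = a * Rintegral mu Omega X).
move=> FH; have Cphi n : C_n n phi by have [] := tphi.
have [[_ LDu _] _] := Wu; have [_ iDu] := integrable_enorm_powR p0 mO LDu.
have [iphi igphi] := test_function_integrable_powR p0 oO tphi.
set th := reg_ratio delta eps.
have tPsi := test_function_smoothed_power p e0 tphi.
have [B B0 HB] := test_function_bounded tPsi.
have iPsi : mu.-integrable Omega (EFin \o smoothed_power p eps phi).
  apply: measurable_bounded_integrable => //.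
    by apply: measurable_funTS; have [C _ _] := tPsi;
        exact: continuous_measurable_row (C 0).
  exists B; split; first exact: num_real.
  by move=> y By x _ /=; apply: le_trans (ltW By); have [] := HB x.
have PsiE x : smoothed_power p eps phi x = (phi x ^+ 2 + eps ^+ 2) `^ (p / 2) -
    eps `^ p by [].
have Psi_ge x : `|phi x| `^ p + - eps `^ p <= smoothed_power p eps phi x.
  rewrite PsiE lerD2r (_ : `|phi x| `^ p = (`|phi x| ^+ 2) `^ (p / 2));
      last first.
    by rewrite powR_sqr//; congr (_ `^ _); field.
  rewrite ge0_ler_powR ?nnegrE ?sqr_ge0 ?addr_ge0 ?sqr_ge0 ?divr_ge0 ?(ltW
      p0)//.
  by rewrite real_normK ?num_real// lerDl sqr_ge0.
have s1 : \int[mu]_(x in Omega) (`|phi x| `^ p) + - eps `^ p * fine (mu Omega)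
    <=
    \int[mu]_(x in Omega) smoothed_power p eps phi x.
  have ic := integrable_const mO (- eps `^ p) Ofin.
  rewrite -(Rintegral_cst mu mO) -(RintegralD mO iphi ic).
  apply: ae_le_Rintegral => //; first exact: integrable_add.
  by apply: nearW => x Ox; exact: Psi_ge.
have s2 : \int[mu]_(x in Omega) H x <= - th `^ (p - 1) * \int[mu]_(x in Omega)
    smoothed_power p eps phi x.
  rewrite -RintegralZl//; apply: ae_le_Rintegral => //;
      first exact: integrable_scale.
  apply: filterS uphi => x Hx Ox; rewrite /H.
  have [phi0|/eqP phin0] := pselect (phi x = 0);
      first by rewrite (smoothed_power_eq0 p e0 phi0) mul0r !mulr0.
  have := reaction_pointwise eps p1 d0 (Hx Ox phin0); rewrite -/th.
  (* The pointwise reaction bound is multiplied by this function, so its sign matters. *)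
  have P0 : 0 <= smoothed_power p eps phi x.
    rewrite PsiE -[eps `^ p](_ : (eps ^+ 2) `^ (p / 2) = _); last first.
      by rewrite powR_sqr ?ltW//; congr (_ `^ _); field.
    rewrite subr_ge0 ge0_ler_powR ?nnegrE ?sqr_ge0 ?addr_ge0 ?sqr_ge0 ?divr_ge0
        ?(ltW p0)//.
    by rewrite lerDr sqr_ge0.
  move=> /(ler_wpM2r P0); rewrite /reg_powR; apply: le_trans.
  by rewrite le_eqVlt; apply/orP; left; apply/eqP; ring.
pose c := (p - 1) * (eps `^ p * delta `^ (- p)).
have c0 : 0 <= c by rewrite !mulr_ge0 ?powR_ge0//; lra.
have i1 := integrable_scale mO c iDu.
have i2 := integrable_scale mO (th `^ (1 - p)) igphi.
have i12 := integrable_add mO i1 i2.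
have s3 : (- (\int[mu]_(x in Omega) (c * enorm (Du x) `^ p + th `^ (1 - p) *
    enorm (grad phi x) `^ p))) <=
    \int[mu]_(x in Omega) F x.
  apply: le_trans (ae_le_Rintegral mO (integrable_scale mO (-1) i12) iF _).
    by rewrite RintegralZl// mulN1r.
  apply: filterS uphi => x Hx Ox; rewrite mulN1r /F (grad_smoothed_power p e0
      tphi x) dotZr.
  (* Where [phi] vanishes no bound on [u] is assumed, but there [smoothed_power] and its gradient
     vanish, hence so does the integrand. *)
  have [phi0|/eqP phin0] := pselect (phi x = 0).
    rewrite (smoothed_power_eq0 p e0 phi0) phi0 !(mulr0,
        mul0r) addr0 mulr0 oppr_le0.
    by apply: addr_ge0; apply: mulr_ge0 => //; exact: powR_ge0.
  exact: (picone_pointwise (phi x) (Du x) (grad phi x) p1 d0 e0 (Hx Ox phin0)).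
rewrite (RintegralD mO i1 i2) (RintegralZl c mO iDu) (RintegralZl _ mO igphi)
    in s3.
have t0 : 0 <= th `^ (p - 1) by exact: powR_ge0.
have s4 := ler_wpM2l a0 (ler_wpM2l t0 s1).
have s5 := ler_wpM2l a0 s2.
rewrite -FH in s5.
apply: le_trans s4 _; rewrite -/c -/th.
apply: (le_trans (y := - \int[mu]_(x in Omega) F x)); last by rewrite lerNl.
by rewrite lerNr; rewrite mulNr mulrN in s5.
Qed.

Lemma reg_ratio_cvg (delta r : R) : 0 < delta ->
  reg_ratio delta eps `^ r @[eps --> 0^'+] --> (1 : R).
Proof.
move=> d0.
have cr : continuous (fun eps : R => reg_ratio delta eps `^ r).
  move=> e; apply: (@continuous_comp _ _ _ (reg_ratio delta) (fun y : R =>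
      y `^ r)); last first.
    apply: differentiable_continuous; apply/derivable1_diffP.
    by have [] := is_derive1_powR r (reg_ratio_gt0 e d0).
  apply: cvgMl_tmp; apply: cvgV.
    by rewrite gt_eqF// sqrtr_gt0 ltr_wpDr ?sqr_ge0 ?exprn_gt0.
  apply: (@continuous_comp _ _ _ (fun eps : R =>
      delta ^+ 2 + eps ^+ 2) (@Num.sqrt R)); last exact: sqrt_continuous.
  by apply: cvgD; [exact: cvg_cst|exact: exprn_continuous].
have -> : 1 = reg_ratio delta 0 `^ r :> R.
  by rewrite /reg_ratio expr0n/= addr0 sqrtr_sqr gtr0_norm// divff ?gt_eqF//
      powR1.
by apply: cvg_at_right_filter; exact: cr.
Qed.

(** [delta] stays fixed while [eps] tends to 0: the ratio tends to 1 and both error terms carry the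
    factor [eps^p]. *)
Lemma picone_test_function (p a delta : R) (Omega : set 'rV[R]_N)
    (f u : 'rV[R]_N -> R) (Du : 'rV[R]_N -> 'rV[R]_N) (phi : 'rV[R]_N -> R) :
  1 < p -> 0 <= a -> 0 < delta -> open Omega -> (mu Omega < +oo)%E ->
  measurable_fun Omega f -> W01p p Omega u Du ->
  (forall xi Dxi, W01p p Omega xi Dxi ->
    \int[mu]_(x in Omega) (enorm (Du x) `^ (p - 2) * dot (Du x) (Dxi x)) =
    a * \int[mu]_(x in Omega) (`|u x| `^ (p - 2) * u x * xi x)
    + \int[mu]_(x in Omega) (f x * xi x)) ->
  test_function Omega phi ->
  {ae mu, forall x, Omega x -> phi x != 0 -> f x = 0} ->
  {ae mu, forall x, Omega x -> phi x != 0 -> u x <= - delta} ->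
  a * \int[mu]_(x in Omega) (`|phi x| `^ p) <=
  \int[mu]_(x in Omega) (enorm (grad phi x) `^ p).
Proof.
move=> p1 a0 d0 oO Ofin mf Wu weq tphi fphi uphi.
have p0 : 0 < p by rewrite (lt_trans _ p1).
set I := Rintegral _ _ _; set J := Rintegral _ _ _.
pose K := \int[mu]_(x in Omega) (enorm (Du x) `^ p).
have ep0 : eps `^ p @[eps --> 0^'+] --> (0 : R) := powR_cvg0 p0.
have cl : a * (reg_ratio delta eps `^ (p - 1) * (I + - eps `^ p * fine (mu
    Omega)))
    @[eps --> 0^'+] --> a * (1 * (I + - 0 * fine (mu Omega))).
  apply: cvgMl_tmp; apply: cvgM; first exact: reg_ratio_cvg.
  apply: cvgD; first exact: cvg_cst.
  by apply: cvgMr_tmp; exact: cvgN.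
have cr : (p - 1) * (eps `^ p * delta `^ (- p)) * K + reg_ratio delta eps `^ (1
    - p) * J
    @[eps --> 0^'+] --> (p - 1) * (0 * delta `^ (- p)) * K + 1 * J.
  apply: cvgD; last by apply: cvgMr_tmp; exact: reg_ratio_cvg.
  by apply: cvgMr_tmp; apply: cvgMl_tmp; exact: cvgMr_tmp.
have : a * (1 * (I + - 0 * fine (mu Omega))) <=
    (p - 1) * (0 * delta `^ (- p)) * K + 1 * J.
  apply: (ler_cvg_to cl cr); near=> eps.
  by apply: (picone_regularized (f := f) (u := u)).
by rewrite oppr0 !mul0r mulr0 mul0r addr0 add0r !mul1r.
Unshelve. all: by end_near. Qed.

(** Both integrals converge along the approximating test functions, by dominated convergence with
    majorants [2^p (|u|^p + S)] and [2^p (|Du|^p + S)]. *)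
Lemma rayleigh_closure (p a : R) (U : set 'rV[R]_N) (u : 'rV[R]_N -> R)
    (Du : 'rV[R]_N -> 'rV[R]_N) : 0 < p -> open U -> W01p p U u Du ->
  (forall phi, test_function U phi ->
    a * \int[mu]_(x in U) (`|phi x| `^ p) <= \int[mu]_(x in U) (enorm (grad phi
        x) `^ p)) ->
  a * \int[mu]_(x in U) (`|u x| `^ p) <= \int[mu]_(x in U) (enorm (Du x) `^ p).
Proof.
move=> p0 oU Wu Hphi; have mU := open_measurable_row oU.
have [[Lu LDu _] _] := Wu.
have [mu_ iu] := (Lp_powR u p0 mU).1 Lu.
have [mDu iDu] := integrable_enorm_powR p0 mU LDu.
have [phik [S [tk iS cvk domk]]] := W01p_approximation p0 oU Wu.
have powc (y : nat -> R) (l : R) : (forall k, 0 <= y k) -> y k @[k --> \oo] -->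
    l ->
    y k `^ p @[k --> \oo] --> l `^ p.
  move=> y0 yl; have l0 : 0 <= l.
    by rewrite -(cvg_lim (@Rhausdorff R) yl); apply: limr_ge;
        [exact: cvgP yl|exact: nearW].
  (* Differentiability gives continuity of the power only at positive limits; at 0 the threshold
     [e^(1/p)] is used. *)
  have [l00|ln0] := eqVneq l 0; last first.
    have lgt0 : 0 < l by rewrite lt_neqAle eq_sym ln0.
    have cp : {for l, continuous (fun t : R => t `^ p)}.
      apply: differentiable_continuous; apply/derivable1_diffP.
      by have [] := is_derive1_powR p lgt0.
    exact: (cvg_comp _ _ yl cp).
  rewrite l00 powR0 ?gt_eqF//; apply/cvgr0Pnorm_le => e e0.
  have e10 : 0 < e `^ p^-1 by rewrite powR_gt0.
  move: yl; rewrite l00 => /cvgr0Pnorm_le/(_ _ e10); apply: filterS => k.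
  rewrite (ger0_norm (y0 k)) (ger0_norm (powR_ge0 _ _)) => ye.
  apply: (@le_trans _ _ ((e `^ p^-1) `^ p)).
    by rewrite ge0_ler_powR ?nnegrE ?(ltW p0) ?powR_ge0.
  by rewrite -powRrM mulVf ?gt_eqF// powRr1// ltW.
have dom (x0 y0 z0 w0 : R) : 0 <= x0 -> 0 <= y0 -> 0 <= z0 -> x0 <= y0 + z0 ->
    z0 `^ p <= w0 ->
    `|x0 `^ p| <= 2 `^ p * (y0 `^ p + w0).
  move=> x00 y00 z00 xyz zw; rewrite (ger0_norm (powR_ge0 _ _)).
  apply: (@le_trans _ _ ((y0 + z0) `^ p)).
    by rewrite ge0_ler_powR ?nnegrE ?addr_ge0// ltW.
  apply: le_trans (powRD_le (ltW p0) y00 z00) _.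
  by rewrite ler_wpM2l ?powR_ge0// lerD2l.
have Ck k n : C_n n (phik k) by have [] := tk k.
have mpow (h : 'rV[R]_N -> R) : measurable_fun U h ->
    measurable_fun U (fun x => h x `^ p).
  by move=> mh; apply: (measurableT_comp (measurable_powR p)).
have mabs (h : 'rV[R]_N -> R) : measurable_fun U h ->
    measurable_fun U (fun x => `|h x|).
  by move=> mh; exact: (measurableT_comp (@normr_measurable _ setT) mh).
have [_ cI] : mu.-integrable U (EFin \o (fun x => `|u x| `^ p)) /\
    \int[mu]_(x in U) (`|phik k x| `^ p) @[k --> \oo] -->
        \int[mu]_(x in U) (`|u x| `^ p).
  apply: (@dominated_Rintegral _ _ _ _ _ mU _ _ (fun x =>
      2 `^ p * (`|u x| `^ p + S x))) => //.
  - move=> k; have mk : measurable_fun U (phik k).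
      by apply: measurable_funTS; exact: continuous_measurable_row (Ck k 0).
    exact: (mpow _ (mabs _ mk)).
  - exact: (mpow _ (mabs _ mu_)).
  - apply: filterS cvk => x Hx Ux; have [c _] := Hx Ux.
    by apply: powc => //; exact: cvg_norm.
  - by apply: integrable_scale => //; exact: integrable_add.
  - apply: filterS domk => x Hx Ux k.
    apply: (dom _ _ `|u x - phik k x|) => //.
      by rewrite -{1}[phik k x](subKr (u x)) ler_normB.
    by apply: le_trans (Hx Ux k); rewrite lerDl powR_ge0.
have [_ cJ] : mu.-integrable U (EFin \o (fun x => enorm (Du x) `^ p)) /\
    \int[mu]_(x in U) (enorm (grad (phik k) x) `^ p) @[k --> \oo] -->
        \int[mu]_(x in U) (enorm (Du x) `^ p).
  apply: (@dominated_Rintegral _ _ _ _ _ mU _ _ (fun x =>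
      2 `^ p * (enorm (Du x) `^ p + S x))) => //.
  - move=> k; apply: mpow; apply: measurable_enorm => i;
      apply: measurable_funTS.
    by apply: measurable_grad; exact: Ck.
  - by apply: mpow; exact: measurable_enorm.
  - apply: filterS cvk => x Hx Ux; have [_ c] := Hx Ux.
    apply: powc => [k|]; first exact: enorm_ge0.
    apply/cvgrPdist_le => e e0; move/cvgr0Pnorm_le : c => /(_ e e0).
    apply: filterS => k; rewrite ger0_norm ?enorm_ge0//; apply: le_trans.
    have t1 := enorm_triangle (Du x - grad (phik k) x) (grad (phik k) x).
    have t2 := enorm_triangle (- (Du x - grad (phik k) x)) (Du x).
    rewrite subrK in t1; rewrite enormN opprB subrK in t2.
    by rewrite ler_norml; apply/andP; split; lra.
  - by apply: integrable_scale => //; exact: integrable_add.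
  - apply: filterS domk => x Hx Ux k.
    apply: (dom _ _ (enorm (Du x - grad (phik k) x))); rewrite ?enorm_ge0//.
      have := enorm_triangle (Du x) (- (Du x - grad (phik k) x)).
      by rewrite enormN subKr.
    by apply: le_trans (Hx Ux k); rewrite lerDr powR_ge0.
have caI : a * \int[mu]_(x in U) (`|phik k x| `^ p) @[k --> \oo] -->
    a * \int[mu]_(x in U) (`|u x| `^ p).
  exact: cvgMl_tmp cI.
by apply: (ler_cvg_to caI cJ); apply: nearW => k; exact: Hphi.
Qed.

End picone_inequality.

(** * Comparison of [lambda_f] with the first eigenvalue *)

Section rayleigh_quotient.
Context {R : realType} {N : nat}.
Local Notation mu := (@lebesgue R N).

Lemma Rintegral_powR_gt0 (p : R) U (u : 'rV[R]_N -> R) : 0 < p -> open U ->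
  Lp p U u -> ~ ae_zero U u -> 0 < \int[mu]_(x in U) (`|u x| `^ p).
Proof.
move=> p0 oU Lu nu; have mU := open_measurable_row oU.
have [mu_ iu] := (Lp_powR u p0 mU).1 Lu.
have I0 : 0 <= \int[mu]_(x in U) (`|u x| `^ p).
  by apply: fine_ge0; apply: integral_ge0 => x _; rewrite lee_fin powR_ge0.
rewrite lt_neqAle I0 andbT; apply/eqP => /esym I00; apply: nu.
have E : (\int[mu]_(x in U) `|(`|u x| `^ p)%:E| = 0)%E.
  under eq_integral => x _ do rewrite abse_EFin ger0_norm ?powR_ge0//.
  by rewrite -[LHS]fineK ?integrable_fin_num//; congr EFin.
have := (ae_eq_integral_abs mu mU (measurable_int _ iu)).1 E.
apply: filterS => x Hx Ux; have := Hx Ux => -[] /eqP.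
by rewrite powR_eq0 normr_eq0 => /andP[/eqP].
Qed.

Lemma zero_region_open (Omega : set 'rV[R]_N) (f : 'rV[R]_N -> R) :
  open (zero_region Omega f).
Proof. by apply: bigcup_open => U []. Qed.

Lemma zero_region_subset (Omega : set 'rV[R]_N) (f : 'rV[R]_N -> R) :
  zero_region Omega f `<=` Omega.
Proof. by move=> x [U [_ UO _]]; exact: UO. Qed.

(** The zero region is a union of possibly uncountably many open sets, whose exceptional null sets
    cannot simply be united. Compactness leaves finitely many of them. *)
Lemma zero_region_compact_ae (Omega K : set 'rV[R]_N) (f : 'rV[R]_N -> R) :
  compact K -> K `<=` zero_region Omega f -> {ae mu, forall x, K x -> f x = 0}.
Proof.
rewrite compact_cover => cK KZ.
have [|D' D'D KD'] := cK _ [set U | [/\ open U,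
    U `<=` Omega & ae_zero U f]] id _ KZ.
  by move=> U [].
have : \forall x \ae mu, (\bigcap_(U in [set` D']) [set x | U x -> f x = 0]) x.
  by apply: filter_bigI => U /D'D; rewrite inE => -[].
by apply: filterS => x Hx /KD'[U UD' Ux]; exact: (Hx U UD').
Qed.

End rayleigh_quotient.

Theorem proposition1p3 (R : realType) (N : nat) (p gamma : R)
    (Omega : set 'rV[R]_N) (f : 'rV[R]_N -> R)
    (N_ge1 : (1 <= N)%N) (p_gt1 : 1 < p)
    (Omega_bounded : bounded_set Omega) (Omega_C11 : C11_domain Omega)
    (gamma_gtN : N%:R < gamma) (f_Lgamma : Lp gamma Omega f)
    (f_ge0 : {ae lebesgue N, forall x, Omega x -> 0 <= f x})
    (f_neq0 : ~ ae_zero Omega f)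
    (zero_region_neq0 : zero_region Omega f !=set0) :
  (lambda_f p Omega f <= lambda1 p (zero_region Omega f))%E /\
  (lambda1 p (zero_region Omega f) < +oo)%E.
Proof.
have p0 : 0 < p by rewrite (lt_trans _ p_gt1).
have [[oO _ _] _] := Omega_C11.
have mO := open_measurable_row oO.
have Ofin := lebesgue_bounded Omega_bounded mO.
have oZ : open (zero_region Omega f) by exact: zero_region_open.
split; last first.
  have [c Zc] := zero_region_neq0.
  have [phi tphi nphi] := test_function_bump oZ Zc.
  apply: (@le_lt_trans _ _ (rayleigh p (zero_region Omega f) phi (grad
      phi))%:E).
    apply: ereal_inf_lbound; exists phi, (grad phi); split=> //.
    exact: test_function_W01p.
  exact: ltry.
have mf : measurable_fun Omega f.
  have g0 : 0 < gamma by rewrite (le_lt_trans _ gamma_gtN).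
  by have [] := (Lp_powR f g0 mO).1 f_Lgamma.
apply: ge_ereal_sup => _ [a [la [u su] neg] <-].
apply: le_ereal_inf_tmp => _ [w [Dw [Ww nw ->]]]; rewrite lee_fin /rayleigh.
have [[Lw _ _] _] := Ww.
rewrite ler_pdivlMr ?Rintegral_powR_gt0//.
(* The integrated reaction bound is multiplied by [a], which must be nonnegative; for negative [a]
   the left side is at most 0. *)
have [a0|/ltW a0] := leP 0 a; last first.
  apply: (@le_trans _ _ 0).
    by rewrite mulr_le0_ge0// ltW// Rintegral_powR_gt0.
  by apply: fine_ge0; apply: integral_ge0 => x _; rewrite lee_fin powR_ge0.
apply: rayleigh_closure => // phi tphi.
have tphiO := test_function_subset (@zero_region_subset _ _ Omega f) tphi.
(* Admissibility is applied at the parameter [a] itself, to the solution [u]. *)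
have [_ [v [_ [_ [cv _ _] vu vneg _]]]] := neg a la (lexx a) u su.
have [Du Wu weq] := su.
have [_ cK KZ] := tphi.
set K := closure [set x | phi x != 0] in cK KZ.
have phiK x : phi x != 0 -> K x by move=> phix; exact: subset_closure.
(* The continuous representative [v] attains its maximum on the compact support, which lies in
   [Omega], so the maximum is negative. If the support is empty, any value serves. *)
have [delta d0 vK] : exists2 delta, 0 < delta & forall x, K x -> v x <= - delta.
  have [[x0 Kx0]|K0] := pselect (K !=set0); last first.
    by exists 1 => // x Kx; exfalso; apply: K0; exists x.
  have cvK : {within K, continuous v}.
    apply: continuous_subspaceW cv => x /KZ/zero_region_subset Ox.
    exact: subset_closure.
  have [c cK' Hc] := EVT_max_rV (ex_intro _ x0 Kx0) cK cvK.
  exists (- v c) => [|x Kx]; last by rewrite opprK; apply: Hc; rewrite inE.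
  rewrite oppr_gt0; apply: vneg; apply: zero_region_subset.
  by apply: KZ; rewrite inE in cK'.
(* The Rayleigh integrals live on the zero region, the equation on [Omega]; for functions vanishing
   off the zero region the integrals agree. *)
have E g : (forall x, ~ zero_region Omega f x -> g x = 0) ->
    \int[lebesgue N]_(x in zero_region Omega f) g x = \int[lebesgue N]_(x in
        Omega) g x.
  move=> g0; rewrite !Rintegral_support// => x Ox; apply: g0 => Zx; apply: Ox.
  exact: zero_region_subset Zx.
rewrite E; last by move=> x /(test_function_out tphi)[-> _];
    rewrite normr0 powR0// gt_eqF.
rewrite E; last by move=> x /(test_function_out tphi)[_ ->];
    rewrite enorm0 powR0// gt_eqF.
apply: (picone_test_function (f := f) (u := u) (Du := Du) (delta := delta)) =>
    //.
  by apply: filterS (zero_region_compact_ae cK KZ) => x Hx _ /phiK.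
by apply: filterS vu => x Hx Ox /phiK/vK; rewrite Hx.
Qed.
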